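(* Let $\tau$ be any Polish topology on $\mathcal{P}_1(\ell_2)$ lying between WOT and SOT$^*$ (that is, $\mathrm{WOT}\subseteq\tau\subseteq \mathrm{SOT}^*$). Then a typical $T\in(\mathcal{P}_1(\ell_2),\tau)$ is such that $T$ and $T^*$ have no eigenvalue.
   Context: $\ell_2=\ell_2(\mathbb{Z}_+)$ is the complex sequence space, $\mathbb{Z}_+=\{0,1,2,\dots\}$, with canonical basis $(e_n)_{n\ge 0}$. A vector $x=\sum_n x_n e_n$ is positive ($x\ge 0$) if $x_n\ge 0$ for all $n$; a bounded operator $T$ on $\ell_2$ is positive if $Tx\ge 0$ whenever $x\ge 0$. $\mathcal{P}_1(\ell_2)$ denotes the set of all positive operators $T$ on $\ell_2$ with $\|T\|\le 1$. The topologies on $\mathcal{P}_1(\ell_2)$ (each is Polish there): WOT: $T_i\to T$ iff $\langle y,T_ix\rangle\to\langle y,Tx\rangle$ for all $x,y$; SOT$^*$: $T_i\to T$ iff $\|T_ix-Tx\|\to 0$ and $\|T_i^*x-T^*x\|\to 0$ for all $x$. A property (P) is satisfied by a typical $T\in(\mathcal{P}_1(\ell_2),\tau)$ if the set of $T\in\mathcal{P}_1(\ell_2)$ satisfying (P) is comeager in $(\mathcal{P}_1(\ell_2),\tau)$, i.e. contains a $\tau$-dense $G_\delta$ subset. *)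

(* Defs.v *)
From HB Require Import structures.
From mathcomp Require Import all_boot all_order all_algebra.
From mathcomp Require Import complex.
From mathcomp Require Import all_classical all_reals all_analysis.
From mathcomp Require Import borel_hierarchy.
From mathcomp Require Import ring lra.

Set Implicit Arguments.
Unset Strict Implicit.
Unset Printing Implicit Defensive.

Import Order.TTheory GRing.Theory Num.Theory.
Import numFieldNormedType.Exports.
Import Normc.

Local Open Scope classical_set_scope.
Local Open Scope ring_scope.
Local Open Scope complex_scope.

Section SquareSummable.
Variable R : realType.
Implicit Types (x y : nat -> R[i]) (a : R[i]).

Definition sqsum x : R^nat := series (fun n => normc (x n) ^+ 2).

Definition square_summable x := cvgn (sqsum x).

Definition seq_norm x : R := Num.sqrt (limn (sqsum x)).

Let psum x n : R := Num.sqrt (sqsum x n).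

Lemma normc_ge0 a : 0 <= normc a.
Proof. by case: a => a b; rewrite sqrtr_ge0. Qed.

Lemma sqsum_ndecr x : nondecreasing_seq (sqsum x).
Proof. by apply: nondecreasing_series => n _ _; rewrite sqr_ge0. Qed.

Lemma sqsum_ge0 x n : 0 <= sqsum x n.
Proof. by apply: sumr_ge0 => i _; rewrite sqr_ge0. Qed.

Lemma sqsumS x n : sqsum x n.+1 = sqsum x n + normc (x n) ^+ 2.
Proof. by rewrite /sqsum !seriesEnat /= big_nat_recr. Qed.

Let psum0 x : psum x 0 = 0.
Proof. by rewrite /psum /sqsum seriesEnat /= big_geq // sqrtr0. Qed.

Let psumS x n : psum x n.+1 = normc (psum x n +i* normc (x n)).
Proof. by rewrite /psum sqsumS /= sqr_sqrtr ?sqsum_ge0. Qed.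

Let psumD x y n : psum (fun k => x k + y k) n <= psum x n + psum y n.
Proof.
elim: n => [|n IH]; first by rewrite !psum0 addr0.
rewrite !psumS.
have /= := le_normcD (psum x n +i* normc (x n)) (psum y n +i* normc (y n)).
apply: le_trans; rewrite ler_wsqrtr // lerD // lerXn2r ?nnegrE //.
- exact: sqrtr_ge0.
- by rewrite addr_ge0 ?sqrtr_ge0.
- exact: normc_ge0.
- by rewrite addr_ge0 ?normc_ge0.
- exact: le_normcD.
Qed.

Let psumZ a x n : psum (fun k => a * x k) n = normc a * psum x n.
Proof.
elim: n => [|n IH]; first by rewrite !psum0 mulr0.
rewrite !psumS IH /= normcM !exprMn -mulrDr sqrtrM ?sqr_ge0 //.
by rewrite sqrtr_sqr ger0_norm ?normc_ge0.
Qed.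

Lemma psum_le x n : square_summable x -> Num.sqrt (sqsum x n) <= seq_norm x.
Proof.
move=> cx; rewrite ler_wsqrtr //.
exact: nondecreasing_cvgn_le (@sqsum_ndecr x) cx n.
Qed.

Lemma psum_bound x (M : R) : (forall n, Num.sqrt (sqsum x n) <= M) ->
  square_summable x /\ seq_norm x <= M.
Proof.
move=> H.
have M0 : 0 <= M by apply: le_trans (H 0%N); exact: sqrtr_ge0.
have ub n : sqsum x n <= M ^+ 2.
  by rewrite -(sqr_sqrtr (sqsum_ge0 x n)) lerXn2r ?nnegrE ?sqrtr_ge0 // H.
have cx : square_summable x.
  apply: nondecreasing_is_cvgn; first exact: sqsum_ndecr.
  by exists (M ^+ 2) => _ [n _ <-].
split => //.
rewrite -(ger0_norm M0) -sqrtr_sqr ler_wsqrtr // limr_le //.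
exact: nearW.
Qed.

Let summableD x y : square_summable x -> square_summable y ->
  square_summable (fun k => x k + y k) /\
  seq_norm (fun k => x k + y k) <= seq_norm x + seq_norm y.
Proof.
move=> cx cy; apply: psum_bound => n.
by apply: le_trans (psumD x y n) _; rewrite lerD // psum_le.
Qed.

Let summableZ a x : square_summable x ->
  square_summable (fun k => a * x k) /\
  seq_norm (fun k => a * x k) <= normc a * seq_norm x.
Proof.
move=> cx; apply: psum_bound => n.
by rewrite [leLHS]psumZ ler_wpM2l ?normc_ge0 // psum_le.
Qed.

Lemma square_summableD x y : square_summable x -> square_summable y ->
  square_summable (fun k => x k + y k).
Proof. by move=> cx cy; have [] := summableD cx cy. Qed.

Lemma ler_seq_normD x y : square_summable x -> square_summable y ->
  seq_norm (fun k => x k + y k) <= seq_norm x + seq_norm y.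
Proof. by move=> cx cy; have [] := summableD cx cy. Qed.

Lemma square_summableZ a x : square_summable x ->
  square_summable (fun k => a * x k).
Proof. by move=> cx; have [] := summableZ a cx. Qed.

Lemma seq_normZ a x : square_summable x ->
  seq_norm (fun k => a * x k) = normc a * seq_norm x.
Proof.
move=> cx; have [cax le1] := summableZ a cx.
apply/eqP; rewrite eq_le le1 /=.
have [->|a0] := eqVneq a 0; first by rewrite normc0 mul0r sqrtr_ge0.
have [_] := summableZ a^-1 cax.
under [X in seq_norm X]eq_fun do rewrite mulKf //.
rewrite normcV mulrC ler_pdivlMr 1?mulrC //.
rewrite lt_neqAle normc_ge0 andbT eq_sym.
by apply: contra a0 => /eqP/eq0_normc ->.
Qed.

Lemma square_summable0 : square_summable (fun=> 0 : R[i]).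
Proof.
suff H n : psum (fun=> 0) n <= 0 by have [] := psum_bound H.
elim: n => [|n IH]; first by rewrite psum0.
by rewrite psumS -/(normc (0 : R[i])) normc0 /= expr0n /= addr0 sqrtr_sqr ger0_norm ?sqrtr_ge0.
Qed.

Lemma square_summableN x : square_summable x ->
  square_summable (fun k => - x k).
Proof.
by move=> cx; have := @square_summableZ (-1) x cx; under eq_fun do rewrite mulN1r.
Qed.

Lemma normc_le_seq_norm x n : square_summable x -> normc (x n) <= seq_norm x.
Proof.
move=> cx; apply: le_trans (psum_le n.+1 cx).
rewrite -[leLHS]ger0_norm ?normc_ge0 // -sqrtr_sqr ler_wsqrtr //.
by rewrite sqsumS lerDr sqsum_ge0.
Qed.

End SquareSummable.

Record l2 (R : realType) := L2 {
  l2seq :> nat -> R[i] ;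
  l2P : square_summable l2seq }.
Arguments l2P {R} _.

HB.instance Definition _ (R : realType) := gen_eqMixin (l2 R).
HB.instance Definition _ (R : realType) := gen_choiceMixin (l2 R).

Section L2Module.
Variable R : realType.
Implicit Types (x y z : l2 R) (a b : R[i]).

Lemma l2_ext x y : (forall n, x n = y n) -> x = y.
Proof.
case: x y => x hx [y hy] /= /funext xy; subst y.
by congr L2; exact: Prop_irrelevance.
Qed.

Let l2_zero := L2 (@square_summable0 R).
Let l2_opp x := L2 (square_summableN (l2P x)).
Let l2_add x y := L2 (square_summableD (l2P x) (l2P y)).
Let l2_scale a x := L2 (@square_summableZ R a _ (l2P x)).

Let l2_addA : associative l2_add.
Proof. by move=> x y z; apply: l2_ext => n /=; rewrite addrA. Qed.
Let l2_addC : commutative l2_add.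
Proof. by move=> x y; apply: l2_ext => n /=; rewrite addrC. Qed.
Let l2_add0 : left_id l2_zero l2_add.
Proof. by move=> x; apply: l2_ext => n /=; rewrite add0r. Qed.
Let l2_addN : left_inverse l2_zero l2_opp l2_add.
Proof. by move=> x; apply: l2_ext => n /=; rewrite addNr. Qed.

HB.instance Definition _ :=
  GRing.isZmodule.Build (l2 R) l2_addA l2_addC l2_add0 l2_addN.

Let l2_scaleA a b x : l2_scale a (l2_scale b x) = l2_scale (a * b) x.
Proof. by apply: l2_ext => n /=; rewrite mulrA. Qed.
Let l2_scale1 : left_id 1 l2_scale.
Proof. by move=> x; apply: l2_ext => n /=; rewrite mul1r. Qed.
Let l2_scaleDr : right_distributive l2_scale +%R.
Proof. by move=> a x y; apply: l2_ext => n /=; rewrite mulrDr. Qed.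
Let l2_scaleDl x : {morph l2_scale^~ x : a b / a + b}.
Proof. by move=> a b; apply: l2_ext => n /=; rewrite mulrDl. Qed.

HB.instance Definition _ := GRing.Zmodule_isLmodule.Build R[i] (l2 R)
  l2_scaleA l2_scale1 l2_scaleDr l2_scaleDl.

Lemma l2_0E n : (0 : l2 R) n = 0. Proof. by []. Qed.
Lemma l2_DE x y n : (x + y) n = x n + y n. Proof. by []. Qed.
Lemma l2_NE x n : (- x) n = - x n. Proof. by []. Qed.
Lemma l2_ZE a x n : (a *: x) n = a * x n. Proof. by []. Qed.

Definition l2norm x : R := seq_norm x.

Let l2normD x y : (l2norm (x + y))%:C <= (l2norm x)%:C + (l2norm y)%:C.
Proof. by rewrite -rmorphD /= lecR; apply: ler_seq_normD; exact: l2P. Qed.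

Let l2normZ a x : (l2norm (a *: x))%:C = `|a| * (l2norm x)%:C.
Proof.
have -> : `|a| = (normc a)%:C by [].
by rewrite -rmorphM /= -seq_normZ //; exact: l2P.
Qed.

Let l2norm_eq0 x : (l2norm x)%:C = 0 -> x = 0.
Proof.
case=> x0; apply: l2_ext => n; apply: eq0_normc; apply/eqP.
by rewrite eq_le normc_ge0 andbT -[leRHS]x0 normc_le_seq_norm //; exact: l2P.
Qed.

HB.instance Definition _ :=
  Lmodule_isNormed.Build R[i] (l2 R) l2normD l2normZ l2norm_eq0.

Lemma l2normE x : `|x| = (l2norm x)%:C. Proof. by []. Qed.

End L2Module.

(* Linear in the first variable. *)
Definition inner (R : realType) (x y : l2 R) : R[i]^o :=
  limn (series (fun n => x n * (y n)^*%C : R[i]^o)).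

Section Operators.
Variable R : realType.
Implicit Types (x y : l2 R) (T : {linear l2 R -> l2 R}).

Definition bounded_op T :=
  has_ubound [set l2norm (T x) | x in [set x | l2norm x <= 1]].

Definition opnorm T : R :=
  sup [set l2norm (T x) | x in [set x | l2norm x <= 1]].

(* In R[i], [0 <= z] means that z is a nonnegative real number. *)
Definition positive_vec x := forall n, 0 <= x n.

Definition positive_op T := forall x, positive_vec x -> positive_vec (T x).

(* The choice has a witness for every positive contraction: see
   [inner_adjoint] below. *)
Definition adjoint (T : l2 R -> l2 R) : l2 R -> l2 R :=
  fun y => xget 0 [set z | forall x, inner (T x) y = inner x z].

Definition is_eigenvalue (T : l2 R -> l2 R) (a : R[i]) :=
  exists2 x, x != 0 & T x = a *: x.

Definition no_eigenvalue (T : l2 R -> l2 R) := forall a, ~ is_eigenvalue T a.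

Record P1 := MkP1 {
  P1op :> {linear l2 R -> l2 R} ;
  P1opP : [/\ bounded_op P1op, opnorm P1op <= 1 & positive_op P1op] }.

HB.instance Definition _ := gen_eqMixin P1.
HB.instance Definition _ := gen_choiceMixin P1.

(* [Topological X] is the type of topological structures on the carrier X. *)
Definition WOT : Topological P1 := Topological.class (initial_topology
  (fun T : P1 => (fun p => inner p.1 (T p.2))
     : {ptws (l2 R * l2 R)%type -> R[i]^o})).

Definition SOTs : Topological P1 := Topological.class (initial_topology
  (fun T : P1 => (fun x => (T x, adjoint T x))
     : {ptws l2 R -> (l2 R * l2 R)%type})).

End Operators.

Definition coarser (X : Type) (tau1 tau2 : Topological X) :=
  forall A : set X,
    @open (Topological.Pack tau1) A -> @open (Topological.Pack tau2) A.

Definition separable (X : topologicalType) :=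
  exists2 D : set X, countable D & dense D.

Definition completely_metrizable (R : realType) (X : topologicalType) :=
  exists (Y : metricType R) (f : X -> Y) (g : Y -> X),
    [/\ cancel f g, cancel g f, continuous f, continuous g &
        forall F : set_system Y,
          ProperFilter F -> cauchy F -> exists p : Y, F --> p].

Definition polish (R : realType) (X : topologicalType) :=
  separable X /\ completely_metrizable R X.

Definition comeager (X : topologicalType) (A : set X) :=
  exists G : set X, [/\ Gdelta G, dense G & G `<=` A].

Definition typical (X : Type) (tau : Topological X) (P : X -> Prop) :=
  @comeager (Topological.Pack tau) [set x | P x].

Section InnerTheory.
Variable R : realType.
Implicit Types (x y z : l2 R) (a : R[i]).

Let cvg_complex (u : nat -> R[i]) (a b : R) :
  (fun n => complex.Re (u n)) @ \oo --> a -> (fun n => complex.Im (u n)) @ \oo --> b ->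
  (u : nat -> R[i]^o) @ \oo --> (a +i* b : R[i]^o).
Proof.
move=> ua ub; apply/cvgrPdist_lt => e e0.
have [er ei] : 0 < complex.Re e /\ complex.Im e = 0.
  by move: e0; rewrite ltcE /= => /andP[/eqP -> ->].
near=> n.
have h1 : `|a - complex.Re (u n)| < complex.Re e / 2.
  by near: n; move/cvgrPdist_lt: ua; apply; rewrite divr_gt0.
have h2 : `|b - complex.Im (u n)| < complex.Re e / 2.
  by near: n; move/cvgrPdist_lt: ub; apply; rewrite divr_gt0.
have -> : (a +i* b - u n : R[i]) = (a - complex.Re (u n)) +i* 0 + 0 +i* (b - complex.Im (u n)).
  by case: (u n) => c d /=; simpc.
apply: le_lt_trans (ler_normD _ _) _.
rewrite !normc_def /= expr0n /= addr0 add0r !sqrtr_sqr -rmorphD /=.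
by rewrite ltcE /= ei eqxx /= [ltRHS]splitr ltrD.
Unshelve. all: by end_near. Qed.

Let normc_prod_cvg x y : cvgn (series (fun n => normc (x n) * normc (y n))).
Proof.
have h : cvgn (series (fun n => normc (x n) ^+ 2 + normc (y n) ^+ 2)).
  have -> : (fun n => normc (x n) ^+ 2 + normc (y n) ^+ 2) =
    (fun n => normc (x n) ^+ 2) + (fun n => normc (y n) ^+ 2) by [].
  by rewrite seriesD; apply: is_cvgD; exact: l2P.
apply: series_le_cvg h => n.
- by rewrite mulr_ge0 ?normc_ge0.
- by rewrite addr_ge0 ?sqr_ge0.
have a0 := normc_ge0 (x n); have b0 := normc_ge0 (y n).
have := sqr_ge0 (normc (x n) - normc (y n)).
rewrite sqrrB => h.
have h2 : normc (x n) * normc (y n) *+ 2 <= normc (x n) ^+ 2 + normc (y n) ^+ 2.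
  by rewrite -subr_ge0 addrAC.
by apply: le_trans h2; rewrite mulr2n lerDl mulr_ge0.
Qed.

Let ReE (u : nat -> R[i]) n : complex.Re (series u n) = series (fun k => complex.Re (u k)) n.
Proof.
elim: n => [|n IH]; first by rewrite !seriesEnat /= !big_geq.
move: IH; rewrite !seriesEnat /= !big_nat_recr //= => <-.
by case: (\sum_(_ <= _ < _) _) (u n) => ? ? [].
Qed.

Let ImE (u : nat -> R[i]) n : complex.Im (series u n) = series (fun k => complex.Im (u k)) n.
Proof.
elim: n => [|n IH]; first by rewrite !seriesEnat /= !big_geq.
move: IH; rewrite !seriesEnat /= !big_nat_recr //= => <-.
by case: (\sum_(_ <= _ < _) _) (u n) => ? ? [].
Qed.

Lemma inner_cvg x y :
  series (fun n => x n * (y n)^*%C : R[i]^o) @ \oo --> inner x y.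
Proof.
rewrite /inner; set u := fun n => _.
have hre (f : R[i] -> R) : (forall w, `|f w| <= normc w) ->
    cvgn (series (fun n => f (u n))).
  move=> hf; apply: normed_cvg.
  apply: (series_le_cvg _ _ _ (@normc_prod_cvg x y)) => n //=.
  - by rewrite mulr_ge0 ?normc_ge0.
  - apply: le_trans (hf _) _; rewrite /u normcM.
    by rewrite ler_wpM2l ?normc_ge0 //; case: (y n) => c d /=; rewrite sqrrN.
have c1 := hre (@complex.Re R) _; have c2 := hre (@complex.Im R) _.
have {c1}c1 : cvgn (series (fun n => complex.Re (u n))).
  apply: c1 => -[c d] /=; rewrite -sqrtr_sqr ler_wsqrtr //.
  by rewrite lerDl sqr_ge0.
have {c2}c2 : cvgn (series (fun n => complex.Im (u n))).
  apply: c2 => -[c d] /=; rewrite -sqrtr_sqr ler_wsqrtr //.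
  by rewrite lerDr sqr_ge0.
have H : (series u : nat -> R[i]^o) @ \oo -->
   ((limn (series (fun n => complex.Re (u n))) +i*
     limn (series (fun n => complex.Im (u n)))) : R[i]^o).
  apply: (@cvg_complex (series u)).
  - by under eq_fun do rewrite ReE.
  - by under eq_fun do rewrite ImE.
exact: (cvgP _ H).
Qed.

Lemma inner_eq x y (l : R[i]) :
  series (fun n => x n * (y n)^*%C : R[i]^o) @ \oo --> (l : R[i]^o) ->
  inner x y = l.
Proof. by move=> h; apply: cvg_lim h; exact: norm_hausdorff. Qed.

Lemma innerD x y z : inner (x + y) z = inner x z + inner y z.
Proof.
apply: inner_eq.
have -> : (fun n => (x + y) n * (z n)^*%C : R[i]^o) =
  (fun n => x n * (z n)^*%C : R[i]^o) + (fun n => y n * (z n)^*%C : R[i]^o).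
  by apply/funext => n; rewrite l2_DE mulrDl.
by rewrite seriesD; apply: cvgD; exact: inner_cvg.
Qed.

Lemma innerZ a x z : inner (a *: x) z = a * inner x z.
Proof.
apply: inner_eq.
have -> : (fun n => (a *: x) n * (z n)^*%C : R[i]^o) =
  a *: (fun n => x n * (z n)^*%C : R[i]^o).
  by apply/funext => n; rewrite l2_ZE -mulrA.
by rewrite seriesZ; apply: cvgZr; exact: inner_cvg.
Qed.

Lemma inner_le x y : normc (inner x y) <= l2norm x * l2norm y.
Proof.
have H n : normc (series (fun n => x n * (y n)^*%C : R[i]^o) n) <=
    Num.sqrt (sqsum x n) * Num.sqrt (sqsum y n).
  elim: n => [|n IH].
    by rewrite /sqsum !seriesEnat /= !big_geq // sqrtr0 mul0r -/(normc (0 : R[i])) normc0.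
  rewrite !sqsumS -sqrtrM ?addr_ge0 ?sqsum_ge0 ?sqr_ge0 //.
  set S := series _ _.
  have -> : S = series (fun n => x n * (y n)^*%C : R[i]^o) n + x n * (y n)^*%C.
    by rewrite /S !seriesEnat /= big_nat_recr.
  apply: le_trans (le_normcD _ _) _; rewrite normcM.
  have -> : normc (y n)^*%C = normc (y n) by case: (y n) => c d /=; rewrite sqrrN.
  apply: le_trans (lerD IH (lexx _)) _.
  set A := Num.sqrt _; set B := Num.sqrt _; set a := normc _; set b := normc _.
  have -> : sqsum x n = A ^+ 2 by rewrite sqr_sqrtr ?sqsum_ge0.
  have -> : sqsum y n = B ^+ 2 by rewrite sqr_sqrtr ?sqsum_ge0.
  have A0 : 0 <= A by exact: sqrtr_ge0.
  have B0 : 0 <= B by exact: sqrtr_ge0.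
  have a0 : 0 <= a by exact: normc_ge0.
  have b0 : 0 <= b by exact: normc_ge0.
  rewrite -[leLHS]ger0_norm ?addr_ge0 ?mulr_ge0 // -sqrtr_sqr ler_wsqrtr //.
  have := sqr_ge0 (A * b - a * B).
  rewrite -subr_ge0 => h; rewrite -subr_ge0; apply: le_trans h _.
  rewrite le_eqVlt; apply/orP; left; apply/eqP.
  by rewrite !expr2; ring.
apply/ler_addgt0Pr => e e0.
have /cvgrPdist_lt/(_ e%:C) := @inner_cvg x y.
rewrite ltcR => /(_ e0)/filter_ex[n hn].
have {hn} : normc (inner x y - series (fun n => x n * (y n)^*%C : R[i]^o) n) < e.
  by rewrite -ltcR.
move=> /ltW hn; set S := series _ n in hn *.
have -> : inner x y = S + (inner x y - S) by rewrite addrC subrK.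
apply: le_trans (le_normcD _ _) _; rewrite lerD //.
apply: le_trans (H n) _; rewrite ler_pM ?sqrtr_ge0 //; apply: psum_le; exact: l2P.
Qed.

Let basis_summable N : square_summable (fun n => (n == N)%:R : R[i]).
Proof.
suff H n : Num.sqrt (sqsum (fun n => (n == N)%:R : R[i]) n) <= 1 by have [] := psum_bound H.
rewrite -[leRHS]sqrtr1 ler_wsqrtr //.
have -> : sqsum (fun n => (n == N)%:R : R[i]) n = (N < n)%:R; last by case: ltnP.
elim: n => [|n IH]; first by rewrite /sqsum seriesEnat /= big_geq.
rewrite sqsumS IH ltnS [(N <= n)%N]leq_eqVlt [N == n]eq_sym.
have [->|_] := eqVneq n N; first by rewrite ltnn normc1 expr1n add0r.
by rewrite normc0 expr0n addr0.
Qed.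

Let ebasis N : l2 R := L2 (@basis_summable N).

Let trunc (u : nat -> R[i]) N : l2 R := \sum_(k < N) u k *: ebasis k.

Let truncE u N n : trunc u N n = if (n < N)%N then u n else 0.
Proof.
rewrite /trunc; elim: N => [|N IH]; first by rewrite big_ord0.
rewrite big_ord_recr l2_DE IH l2_ZE /= ltnS [(n <= N)%N]leq_eqVlt.
case: eqVneq => [->|_] /=; first by rewrite ltnn add0r mulr1.
by rewrite mulr0 addr0.
Qed.

Let sqsum_trunc u N n : sqsum (trunc u N) n = sqsum u (minn N n).
Proof.
elim: n => [|n IH]; first by rewrite minn0 /sqsum !seriesEnat /= !big_geq.
rewrite sqsumS IH truncE; have [h|h] := boolP (n < N)%N.
  by rewrite (minn_idPr (ltnW h)) (minn_idPr h) sqsumS.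
rewrite -leqNgt in h.
by rewrite (minn_idPl h) (minn_idPl (leqW h)) normc0 expr0n addr0.
Qed.

Let l2norm_trunc u N : l2norm (trunc u N) = Num.sqrt (sqsum u N).
Proof.
congr Num.sqrt; apply: cvg_lim => //.
apply: cvg_near_cst; near=> n; rewrite sqsum_trunc (minn_idPl _) //.
by near: n; exact: nbhs_infty_ge.
Unshelve. all: by end_near. Qed.

Let trunc_cvg x : (fun N => l2norm (x - trunc x N)) @ \oo --> (0 : R).
Proof.
pose L := limn (sqsum x).
have HL : (fun N => Num.sqrt (L - sqsum x N)) @ \oo --> (0 : R).
  have h0 : (fun N => L - sqsum x N) @ \oo --> (0 : R).
    rewrite -[X in _ --> X](subrr L); apply: cvgB; first exact: cvg_cst.
    exact: l2P.
  rewrite -[X in _ --> X]sqrtr0.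
  exact: (cvg_comp _ _ h0 (@sqrt_continuous R 0)).
apply: (@squeeze_cvgr _ _ _ _ (fun=> 0) (fun N => Num.sqrt (L - sqsum x N))) => //; last exact: cvg_cst.
apply: nearW => N; rewrite /l2norm sqrtr_ge0 /=.
apply: (psum_bound _).2 => n; rewrite ler_wsqrtr //.
have h m : sqsum x m <= L.
  by apply: nondecreasing_cvgn_le; [exact: sqsum_ndecr|exact: l2P].
have -> : sqsum (x - trunc x N) n = sqsum x n - sqsum x (minn N n).
  elim: n => [|n IH]; first by rewrite minn0 subrr /sqsum !seriesEnat /= !big_geq.
  rewrite !sqsumS IH l2_DE l2_NE truncE; have [hn|hn] := boolP (n < N)%N.
    rewrite subrr normc0 expr0n addr0.
    by rewrite (minn_idPr (ltnW hn)) (minn_idPr hn) sqsumS !subrr.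
  rewrite -leqNgt in hn.
  by rewrite subr0 (minn_idPl hn) (minn_idPl (leqW hn)) addrAC.
have [hn|hn] := boolP (N <= n)%N; first by rewrite (minn_idPl hn) lerB.
by rewrite -ltnNge in hn; rewrite (minn_idPr (ltnW hn)) subrr subr_ge0.
Qed.

Lemma P1_le (T : P1 R) x : l2norm (T x) <= l2norm x.
Proof.
have [hb h1 _] := P1opP T.
have [x0|x0] := eqVneq (l2norm x) 0.
  have -> : x = 0 by apply: (@normr0_eq0 _ (l2 R)); rewrite l2normE x0.
  by rewrite linear0.
have xp : 0 < l2norm x by rewrite lt_neqAle eq_sym x0 sqrtr_ge0.
pose c : R[i] := ((l2norm x)^-1)%:C.
have nZ y : l2norm (c *: y) = (l2norm x)^-1 * l2norm y.
  rewrite /l2norm (@seq_normZ _ c y) //; last exact: l2P.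
  by rewrite /c /= expr0n addr0 sqrtr_sqr ger0_norm // invr_ge0 ltW.
have : l2norm (T (c *: x)) <= 1.
  apply: le_trans h1; apply: ub_le_sup => //.
  by exists (c *: x) => //=; rewrite nZ mulVf.
by rewrite linearZ nZ mulrC ler_pdivrMr // mul1r.
Qed.

Lemma inner_adjoint (T : P1 R) x y : inner (T x) y = inner x (adjoint T y).
Proof.
suff [z hz] : exists z, forall x, inner (T x) y = inner x z.
  by rewrite /adjoint; case: xgetP => [w _ ->//|/(_ z)/(_ hz)].
pose phi n : R[i] := inner (T (ebasis n)) y.
pose u n := ((phi n)^*)%C.
have phiE (v : nat -> R[i]) N :
    inner (T (trunc v N)) y = series (fun k => v k * phi k : R[i]^o) N.
  elim: N => [|N IH].
    rewrite /trunc big_ord0 linear0 seriesEnat /= big_geq //.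
    by have := innerZ 0 0 y; rewrite scale0r mul0r.
  rewrite /trunc big_ord_recr linearD linearZ innerD innerZ.
  by move: IH; rewrite /trunc => ->; rewrite !seriesEnat /= big_nat_recr.
have su : square_summable u.
  suff H N : Num.sqrt (sqsum u N) <= l2norm y by have [] := psum_bound H.
  have e1 : inner (T (trunc u N)) y = (sqsum u N)%:C.
    rewrite phiE; elim: N => [|N IH].
      by rewrite /sqsum !seriesEnat /= !big_geq.
    rewrite sqsumS rmorphD /= -IH !seriesEnat /= big_nat_recr //=; congr (_ + _).
    rewrite mulrC /u -sqr_normc -normcJ.
    by rewrite rmorphXn.
  have := inner_le (T (trunc u N)) y; rewrite e1 /= expr0n addr0 sqrtr_sqr.
  rewrite ger0_norm ?sqsum_ge0 // => h1.
  have h2 : sqsum u N <= Num.sqrt (sqsum u N) * l2norm y.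
    apply: le_trans h1 _; rewrite ler_wpM2r ?sqrtr_ge0 //.
    by apply: le_trans (P1_le _ _) _; rewrite l2norm_trunc.
  have := sqrtr_ge0 (sqsum u N); rewrite le_eqVlt => /orP[/eqP <-|s0].
    exact: sqrtr_ge0.
  by rewrite -(ler_pM2l s0) -expr2 sqr_sqrtr ?sqsum_ge0.
exists (L2 su) => {}x; apply/esym/inner_eq.
have -> : (fun n => x n * (L2 su n)^*%C : R[i]^o) = (fun n => x n * phi n : R[i]^o).
  by apply/funext => n; rewrite /= /u conjcK.
apply/cvgrPdist_lt => e e0.
have [er ei] : 0 < complex.Re e /\ complex.Im e = 0.
  by move: e0; rewrite ltcE /= => /andP[/eqP -> ->].
have h : (fun N => l2norm (x - trunc x N) * l2norm y) @ \oo --> (0 : R).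
  by rewrite -(mul0r (l2norm y)); apply: cvgMl; exact: trunc_cvg.
move/cvgrPdist_lt: h => /(_ _ er); apply: filterS => N.
rewrite sub0r normrN => h; rewrite -phiE.
have -> : inner (T x) y - inner (T (trunc x N)) y = inner (T (x - trunc x N)) y.
  by rewrite linearB innerD -[- T _]scaleN1r innerZ mulN1r.
change (`|inner (T (x - trunc x N)) y|) with ((normc (inner (T (x - trunc x N)) y))%:C).
rewrite ltcE /= ei eqxx /=; apply: le_lt_trans h.
apply: le_trans (inner_le _ _) _; apply: le_trans (ler_norm _).
by rewrite ler_wpM2r ?sqrtr_ge0 // P1_le.
Qed.
End InnerTheory.

Lemma initial_ptws_cvgP (S : choiceType) (U : topologicalType) (V : uniformType)
  (f : S -> {ptws U -> V}) (F : set_system S) (s : S) : Filter F ->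
  F --> (s : initial_topology f) <->
  forall u, f t u @[t --> F] --> f s u.
Proof.
move=> FF; have -> : (forall u, f t u @[t --> F] --> f s u) <->
    {ptws, f @ F --> f s}.
  by split=> h; [apply/(pointwise_cvgP _)|move/(pointwise_cvgP _) : h].
split=> [Fs|fF].
  apply: cvg_trans (@initial_continuous _ _ f s).
  by move=> A /= fA; exact: Fs.
move=> A [_ [[B oB <-] fsB BA]]; apply: filterS BA _.
by apply: fF; exact: open_nbhs_nbhs.
Qed.

Lemma WOT_cvgP (R : realType) (F : set_system (P1 R)) (T : P1 R) : Filter F ->
  F --> (T : Topological.Pack (WOT R)) <->
  forall x y, inner x (S y) @[S --> F] --> inner x (T y).
Proof.
move=> FF; rewrite (initial_ptws_cvgP _ _ FF); split => [h x y|h [x y]].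
  exact: (h (x, y)).
exact: h.
Qed.

Lemma SOTs_cvgP (R : realType) (F : set_system (P1 R)) (T : P1 R) : Filter F ->
  F --> (T : Topological.Pack (SOTs R)) <->
  forall x, S x @[S --> F] --> T x /\ adjoint S x @[S --> F] --> adjoint T x.
Proof.
move=> FF; rewrite (initial_ptws_cvgP _ _ FF); split => [h x|h x].
  split.
    by apply: (cvg_comp _ fst (h x)); exact: cvg_fst.
  by apply: (cvg_comp _ snd (h x)); exact: cvg_snd.
have [h1 h2] := h x.
have h3 := @cvg_pair _ _ _ F _ _ FF _ _ (fun S : P1 R => S x) (fun S => adjoint S x) h1 h2.
by move=> A hA; exact: h3.
Qed.

(* Main.v *)
Require Import Defs.
From HB Require Import structures.
From mathcomp Require Import all_boot all_order all_algebra.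
From mathcomp Require Import complex.
From mathcomp Require Import all_classical all_reals all_analysis.
From mathcomp Require Import borel_hierarchy.
From mathcomp Require Import ring lra.

(** The set of operators without eigenvalues is not visibly a G_delta for a
topology as coarse as WOT, because the equation [T x = l x] does not pass to
weak limits in [T] and [x] together.  The proof goes through a quantitative
version: call [T] k-flat when every eigenvector [x] satisfies
[k |x_n| <= ||x||] for all [n < k] ([flat_eigenvectors]).  An operator that is
k-flat for all [k] has no eigenvalue, so it is enough that the tau-interiors of
[{T | T and T^* are k-flat}], for [k = 0, 1, 2, ...], have a common tau-dense
set of points.  Their intersection is then a dense G_delta, and no category
argument is involved.

The common points are operators [T] with two properties.

- [T] attains its norm at a strictly positive vector [X] of l2 whose image
  [Y = T X] is strictly positive too, and [T^* Y = X] ([norm_attaining]).  If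
  positive contractions [S] converge weakly to such a [T], then
  [||S X - Y||^2 <= 2 |<S X, Y> - <T X, Y>|] tends to [0], and positivity gives
  [0 <= S e_r <= S X / X_r]: the columns of [S] are dominated by a
  norm-convergent family, so they converge in norm ([column_cvg]).  By symmetry
  the columns of [S^*] converge as well.  Near [T], weak neighbourhoods
  therefore control finitely many columns of [S] and [S^*].

- The coordinates of approximate eigenvectors of [T] and of [T^*] are small
  ([negligible_coord]): if [|l| <= 1] and [l x] agrees with [T x] up to
  [eta ||x||] on sufficiently many coordinates, then [|x_n| <= d ||x||].  An
  eigenvector of an [S] whose adjoint has columns close to those of [T^*] is an
  approximate eigenvector of [T], so [S] is k-flat ([flat_of_close]).

To build such operators near a given [T1], start from a finite nonnegative
matrix [B] on the coordinates [0, ..., m-1], with positive vectors such that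
[B x < y] and [B^T y < x].  Thread a two-sided infinite chain of shifts through
each of the [m] core coordinates: the edge entering the core at [r] has weight
[sqrt (1 - (B x)_r / y_r)], the one leaving it at [c] has weight
[sqrt (1 - (B^T y)_c / x_c)], and the other edges have weight [1]
([flow_construction]).  These weights make up the deficits exactly, so that
[x, y] extend to vectors with [T X = Y] and [T^* Y = X]; Schur's test
([schur_test]) then gives [||T|| <= 1].  Moreover [T] has no approximate
eigenvectors: along an outgoing chain the entries of an eigenvector for
[|l| <= 1] cannot decrease in modulus, hence vanish by square-summability
([negligible_chain]); so the core entries vanish, and the eigenvalue equation
then kills the incoming chains one step at a time ([negligible_backward]).
Passing to [T^*] reverses the chains.

For density ([flow_approx]), shrink the [M x M] corner of [T1] slightly; being
strictly contractive, it has strict Schur vectors ([strict_schur_vectors]).  One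
extra core coordinate, on which both vectors take a large value, absorbs most
of the deficit of the others through matrix entries that are small.  All edges
attached to the first [M] coordinates can thus be given the weight
[g = 1 / (M + 2)], so the first [M] columns of [T] and of [T^*] are close to
those of [T1] and [T1^*]; as [M] grows the operators converge to [T1] in
SOT^*, hence in tau. *)

Set Implicit Arguments.
Unset Strict Implicit.
Unset Printing Implicit Defensive.

Import Order.TTheory GRing.Theory Num.Theory.
Import numFieldNormedType.Exports.
Import Normc.

Local Open Scope classical_set_scope.
Local Open Scope ring_scope.
Local Open Scope complex_scope.

(** * Truncations and inner products in l2 *)

Section Norm.
Variable R : realType.
Implicit Types (x y z : l2 R) (a : R[i]).

Lemma l2norm_ge0 x : 0 <= l2norm x.
Proof. exact: sqrtr_ge0. Qed.

Lemma l2normD x y : l2norm (x + y) <= l2norm x + l2norm y.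
Proof. by apply: ler_seq_normD; exact: l2P. Qed.

Lemma l2normZ a x : l2norm (a *: x) = normc a * l2norm x.
Proof. by apply: seq_normZ; exact: l2P. Qed.

Lemma l2norm0 : l2norm (0 : l2 R) = 0.
Proof. by rewrite -(scale0r 0) l2normZ normc0 mul0r. Qed.

Lemma l2normN x : l2norm (- x) = l2norm x.
Proof. by rewrite -scaleN1r l2normZ normcN normc1 mul1r. Qed.

Lemma l2norm_distC x y : l2norm (x - y) = l2norm (y - x).
Proof. by rewrite -l2normN opprB. Qed.

Lemma l2norm_gt0 x : x != 0 -> 0 < l2norm x.
Proof.
move=> x0; rewrite lt_neqAle l2norm_ge0 andbT eq_sym.
by apply: contra x0 => /eqP n0; rewrite -normr_eq0 l2normE n0.
Qed.

Lemma normc_le_l2norm x n : normc (x n) <= l2norm x.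
Proof. by apply: normc_le_seq_norm; exact: l2P. Qed.

Lemma sqsum_le_l2norm x n : sqsum x n <= l2norm x ^+ 2.
Proof.
rewrite -(sqr_sqrtr (sqsum_ge0 x n)) ler_sqr ?nnegrE ?sqrtr_ge0 ?l2norm_ge0 //.
by apply: psum_le; exact: l2P.
Qed.

Lemma sqsum_bound (u : nat -> R[i]) (C : R) : 0 <= C ->
  (forall n, sqsum u n <= C ^+ 2) -> square_summable u /\ seq_norm u <= C.
Proof.
move=> C0 H; apply: psum_bound => n.
by rewrite -(ger0_norm C0) -sqrtr_sqr ler_wsqrtr.
Qed.

Lemma l2norm_sqsum_bound x (C : R) : 0 <= C -> (forall n, sqsum x n <= C ^+ 2) ->
  l2norm x <= C.
Proof. by move=> C0 H; have [] := sqsum_bound C0 H. Qed.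

Lemma sqsum_cvg x : sqsum x @ \oo --> l2norm x ^+ 2.
Proof.
rewrite sqr_sqrtr; first exact: l2P.
by apply: limr_ge; [exact: l2P|apply: nearW => n; exact: sqsum_ge0].
Qed.

Lemma ler_sqsum (u v : nat -> R[i]) n :
  (forall k, normc (u k) <= normc (v k)) -> sqsum u n <= sqsum v n.
Proof.
move=> uv; elim: n => [|n IH]; first by rewrite /sqsum !seriesEnat /= !big_geq.
by rewrite !sqsumS lerD // ler_sqr ?nnegrE ?normc_ge0.
Qed.

Lemma ler_l2norm x y : (forall k, normc (x k) <= normc (y k)) ->
  l2norm x <= l2norm y.
Proof.
move=> xy; apply: l2norm_sqsum_bound; first exact: l2norm_ge0.
by move=> n; apply: le_trans (ler_sqsum _ xy) (sqsum_le_l2norm _ _).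
Qed.

Lemma sqsumE (u : nat -> R[i]) n : sqsum u n = \sum_(k < n) normc (u k) ^+ 2.
Proof. by rewrite /sqsum seriesEnat /= big_mkord. Qed.

Definition head_seq (N : nat) (u : nat -> R[i]) n := if (n < N)%N then u n else 0.

Lemma sqsum_head_seq N (u : nat -> R[i]) n : sqsum (head_seq N u) n <= sqsum u N.
Proof.
have le k : sqsum (head_seq N u) k <= sqsum u k.
  apply: ler_sqsum => i; rewrite /head_seq.
  by case: ifP => // _; rewrite normc0 normc_ge0.
have [nN|Nn] := leqP n N; first exact: le_trans (le n) (sqsum_ndecr u nN).
rewrite -(subnKC (ltnW Nn)); elim: (n - N)%N => [|k IH]; first by rewrite addn0.
by rewrite addnS sqsumS {2}/head_seq ifN -?leqNgt ?leq_addr // normc0 expr0n addr0.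
Qed.

Lemma head_seq_summable N (u : nat -> R[i]) : square_summable (head_seq N u).
Proof.
suff H n : sqsum (head_seq N u) n <= Num.sqrt (sqsum u N) ^+ 2.
  by have [] := sqsum_bound (sqrtr_ge0 _) H.
by rewrite sqr_sqrtr ?sqsum_ge0 // sqsum_head_seq.
Qed.

(** Locked, so that simplification does not expose the underlying sequence and
    [headE], [tailE], [ebasisE] remain the only ways to compute entries. *)
Definition head N (u : nat -> R[i]) : l2 R :=
  locked (L2 (@head_seq_summable N u)).

Lemma headE N u n : head N u n = if (n < N)%N then u n else 0.
Proof. by rewrite /head -lock. Qed.

Lemma sqsum_head N (u : nat -> R[i]) n : sqsum (head N u) n <= sqsum u N.
Proof. by rewrite /head -lock; exact: sqsum_head_seq. Qed.

Definition tail N x : l2 R := x - head N x.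

Lemma tailE N x n : tail N x n = if (n < N)%N then 0 else x n.
Proof. by rewrite l2_DE l2_NE headE; case: ifP => _; rewrite ?subrr ?subr0. Qed.

Lemma head_tail N x : head N x + tail N x = x.
Proof. by rewrite /tail addrC subrK. Qed.

Lemma tailB N x y : tail N (x - y) = tail N x - tail N y.
Proof.
apply: l2_ext => n; rewrite tailE [RHS]l2_DE [in RHS]l2_NE !tailE.
by case: ltnP => // _; rewrite subrr.
Qed.

Lemma l2norm_tail N x : l2norm (tail N x) <= l2norm x.
Proof.
apply: ler_l2norm => n; rewrite tailE; case: ifP => // _.
by rewrite normc0 normc_ge0.
Qed.

Lemma l2norm_head N x : l2norm (head N x) <= l2norm x.
Proof.
apply: ler_l2norm => n; rewrite headE; case: ifP => // _.
by rewrite normc0 normc_ge0.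
Qed.

Lemma sqsum_tail N x n : sqsum (tail N x) n = sqsum x n - sqsum x (minn N n).
Proof.
elim: n => [|n IH]; first by rewrite minn0 subrr sqsumE big_ord0.
rewrite !sqsumS IH tailE; have [h|h] := ltnP n N.
  by rewrite normc0 expr0n addr0 !(minn_idPr _) ?(ltnW h) // sqsumS !subrr.
by rewrite !(minn_idPl _) ?(leqW h) // addrAC.
Qed.

(** The squared norm of the tail is the remainder of the convergent series of
    squared moduli. *)
Lemma tail_cvg x : (fun N => l2norm (tail N x)) @ \oo --> (0 : R).
Proof.
have h0 : (fun N => l2norm x ^+ 2 - sqsum x N) @ \oo --> (0 : R).
  rewrite -[X in _ --> X](subrr (l2norm x ^+ 2)).
  by apply: cvgB; [exact: cvg_cst|exact: sqsum_cvg].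
have HL : (fun N => Num.sqrt (l2norm x ^+ 2 - sqsum x N)) @ \oo --> (0 : R).
  rewrite -[X in _ --> X]sqrtr0; exact: (cvg_comp _ _ h0 (@sqrt_continuous R 0)).
apply: squeeze_cvgr HL; last exact: cvg_cst.
apply: nearW => N; rewrite l2norm_ge0 /=.
apply: l2norm_sqsum_bound; first exact: sqrtr_ge0.
move=> n; rewrite sqr_sqrtr ?subr_ge0 ?sqsum_le_l2norm // sqsum_tail.
have [hn|hn] := leqP N n; first by rewrite lerB ?sqsum_le_l2norm.
by rewrite subrr subr_ge0 sqsum_le_l2norm.
Qed.

Definition ebasis N : l2 R := head N.+1 (fun n => (n == N)%:R).

Lemma ebasisE N n : ebasis N n = (n == N)%:R.
Proof. by rewrite headE ltnS; case: leqP => // /gtn_eqF ->. Qed.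

Lemma head_sum N (u : nat -> R[i]) : head N u = \sum_(k < N) u k *: ebasis k.
Proof.
apply: l2_ext => n; elim: N => [|N IH]; first by rewrite big_ord0 headE.
rewrite big_ord_recr l2_DE -IH l2_ZE ebasisE !headE ltnS leq_eqVlt.
case: eqVneq => [->|_] /=; first by rewrite ltnn add0r mulr1.
by rewrite mulr0 addr0.
Qed.

Lemma headS N (u : nat -> R[i]) : head N.+1 u = head N u + u N *: ebasis N.
Proof. by rewrite !head_sum big_ord_recr. Qed.

Lemma l2norm_ebasis N : l2norm (ebasis N) <= 1.
Proof.
apply: l2norm_sqsum_bound => // n; rewrite expr1n.
suff -> : sqsum (ebasis N) n = (N < n)%:R by case: ltnP.
elim: n => [|n IH]; first by rewrite sqsumE big_ord0.
rewrite sqsumS IH ebasisE ltnS [(N <= n)%N]leq_eqVlt [N == n]eq_sym.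
have [->|_] := eqVneq n N; first by rewrite ltnn normc1 expr1n add0r.
by rewrite normc0 expr0n addr0.
Qed.

Lemma l2norm_head_le N (u : nat -> R[i]) :
  l2norm (head N u) <= \sum_(k < N) normc (u k).
Proof.
rewrite head_sum; elim: N => [|N IH]; first by rewrite !big_ord0 l2norm0.
rewrite !big_ord_recr; apply: le_trans (l2normD _ _) _; rewrite lerD //.
by rewrite l2normZ ler_piMr ?normc_ge0 ?l2norm_ebasis.
Qed.

End Norm.

Section Inner.
Variable R : realType.
Implicit Types (x y z : l2 R) (a : R[i]).

Lemma normc_conj a : normc (a^*)%C = normc a.
Proof. by case: a => c d /=; rewrite sqrrN. Qed.

Lemma conj_cvg (T : Type) (F : set_system T) (f : T -> R[i]) (l : R[i]) :
  Filter F -> (f : T -> R[i]^o) @ F --> (l : R[i]^o) ->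
  ((fun t => (f t)^*%C) : T -> R[i]^o) @ F --> ((l^*)%C : R[i]^o).
Proof.
move=> FF /cvgrPdist_le h; apply/cvgrPdist_le => e /h; apply: filterS => t.
by rewrite -rmorphB /= normcJ.
Qed.

Lemma inner_conj x y : inner y x = (inner x y)^*%C.
Proof.
apply: inner_eq.
have -> : series (fun n => y n * (x n)^*%C : R[i]^o) =
          (fun N => (series (fun n => x n * (y n)^*%C : R[i]^o) N)^*%C).
  apply/funext => N; rewrite !seriesEnat /= rmorph_sum; apply: eq_bigr => k _.
  by rewrite rmorphM /= conjcK mulrC.
by apply: conj_cvg; exact: inner_cvg.
Qed.

Lemma innerDr x y z : inner x (y + z) = inner x y + inner x z.
Proof. by rewrite inner_conj innerD rmorphD /= -!inner_conj. Qed.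

Lemma innerZr a x y : inner x (a *: y) = (a^*)%C * inner x y.
Proof. by rewrite inner_conj innerZ rmorphM /= -inner_conj. Qed.

Lemma innerBl x y z : inner (x - y) z = inner x z - inner y z.
Proof. by rewrite innerD -scaleN1r innerZ mulN1r. Qed.

Lemma innerBr x y z : inner x (y - z) = inner x y - inner x z.
Proof. by rewrite inner_conj innerBl rmorphB /= -!inner_conj. Qed.

Lemma inner_ebasisr x n : inner x (ebasis R n) = x n.
Proof.
apply: inner_eq; apply: cvg_near_cst; near=> N.
have hN : (n < N)%N by near: N; exact: nbhs_infty_gt.
rewrite seriesEnat /= big_mkord (bigD1 (Ordinal hN)) //= ebasisE eqxx conjc1 mulr1.
rewrite big1 ?addr0 // => -[k kN] /=; rewrite -val_eqE /= => kn.
by rewrite ebasisE (negbTE kn) conjc0 mulr0.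
Unshelve. all: by end_near. Qed.

Lemma inner_ebasisl x n : inner (ebasis R n) x = (x n)^*%C.
Proof. by rewrite inner_conj inner_ebasisr. Qed.

Lemma inner_ext y z : (forall x, inner x y = inner x z) -> y = z.
Proof.
move=> h; apply: l2_ext => n.
by apply: (can_inj (@conjcK R)); rewrite -!inner_ebasisl.
Qed.

Lemma real_cvg_complex (u : R^nat) (l : R) : u @ \oo --> l ->
  ((fun n => (u n)%:C) : nat -> R[i]^o) @ \oo --> (l%:C : R[i]^o).
Proof.
move=> /cvgrPdist_lt h; apply/cvgrPdist_lt => e; rewrite ltcE => /andP[/eqP ei er].
move/(_ _ er): h; apply: filterS => n.
rewrite -rmorphB /= normc_def /= expr0n /= addr0 sqrtr_sqr => hn.
by rewrite ltcE /= ei eqxx.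
Qed.

Lemma inner_norm x : inner x x = (l2norm x ^+ 2)%:C.
Proof.
apply: inner_eq.
have -> : series (fun n => x n * (x n)^*%C : R[i]^o) = (fun N => (sqsum x N)%:C).
  apply/funext => N; rewrite seriesEnat sqsumE /= big_mkord rmorph_sum.
  by apply: eq_bigr => k _; rewrite -sqr_normc rmorphXn.
by apply: real_cvg_complex; exact: sqsum_cvg.
Qed.

Lemma positive_inner x y : positive_vec x -> positive_vec y -> 0 <= inner x y.
Proof.
move=> x0 y0.
suff h : forall e : R, 0 < e -> exists2 s : R[i], 0 <= s & normc (inner x y - s) < e.
  have hI : complex.Im (inner x y) = 0.
    apply/eqP; rewrite -normr_le0; apply/ler_addgt0Pl => e /h [s s0 hs].
    rewrite addr0; apply: ltW; apply: le_lt_trans hs.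
    case: (inner x y) s s0 => a b [c d]; rewrite lecE /= => /andP[/eqP -> _].
    by rewrite oppr0 addr0 -sqrtr_sqr ler_wsqrtr // lerDr sqr_ge0.
  have hR : 0 <= complex.Re (inner x y).
    apply/ler_addgt0Pl => e /h [s s0 /ltW hs].
    have : `|complex.Re (inner x y - s)| <= e.
      apply: le_trans hs; case: (_ - s) => a b /=.
      by rewrite -sqrtr_sqr ler_wsqrtr // lerDl sqr_ge0.
    case: (inner x y) s s0 {hs} => a b [c d]; rewrite lecE /= => /andP[_ c0].
    rewrite ler_norml => /andP[h1 h2]; lra.
  by rewrite lecE /= hI eqxx.
move=> e e0; have /cvgrPdist_lt/(_ e%:C) := @inner_cvg R x y.
rewrite ltcR => /(_ e0)/filter_ex[n hn].
exists (series (fun n => x n * (y n)^*%C : R[i]^o) n); last by rewrite -ltcR.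
rewrite seriesEnat /=; apply: sumr_ge0 => k _.
by rewrite mulr_ge0 // conj_ge0.
Qed.

End Inner.

(** * Adjoints of positive contractions *)

Section Adjoint.
Variable R : realType.
Implicit Types (x y z : l2 R) (a : R[i]) (T : P1 R).

Lemma contraction_opnorm (f : {linear l2 R -> l2 R}) :
  (forall x, l2norm (f x) <= l2norm x) -> bounded_op f /\ opnorm f <= 1.
Proof.
move=> hf.
have ub : ubound [set l2norm (f x) | x in [set x | l2norm x <= 1]] 1.
  by move=> _ [x /= x1 <-]; apply: le_trans (hf x) x1.
split; first by exists 1.
apply: ge_sup => //; exists (l2norm (f 0)); exists 0 => //=.
by rewrite l2norm0.
Qed.

Lemma P1_exists (f : l2 R -> l2 R) :
  (forall a x y, f (a *: x + y) = a *: f x + f y) ->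
  (forall x, l2norm (f x) <= l2norm x) ->
  (forall x, positive_vec x -> positive_vec (f x)) ->
  exists T : P1 R, forall x, T x = f x.
Proof.
move=> flin fle fpos.
pose fl := GRing.isLinear.Build _ _ _ _ f flin.
pose g : {linear l2 R -> l2 R} := HB.pack f fl.
have [gb g1] : bounded_op g /\ opnorm g <= 1 by apply: contraction_opnorm.
by exists (MkP1 (And3 gb g1 (fpos : positive_op g))).
Qed.

Lemma P1_pos T x : positive_vec x -> positive_vec (T x).
Proof. by have [_ _] := P1opP T; apply. Qed.

Lemma ebasis_pos n : positive_vec (ebasis R n).
Proof. by move=> k; rewrite ebasisE ler0n. Qed.

Lemma adjoint_exists T : exists T' : P1 R, forall x, T' x = adjoint T x.
Proof.
apply: P1_exists.
- move=> a x y; apply: inner_ext => z; rewrite innerDr innerZr -!inner_adjoint.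
  by rewrite innerDr innerZr.
- move=> y; have := inner_le (T (adjoint T y)) y.
  rewrite inner_adjoint inner_norm /= expr0n /= addr0 sqrtr_sqr ger0_norm ?sqr_ge0 //.
  move=> h; have [->|y0] := eqVneq (adjoint T y) 0; first by rewrite l2norm0 l2norm_ge0.
  rewrite -(ler_pM2l (l2norm_gt0 y0)) -expr2; apply: le_trans h _.
  by rewrite ler_wpM2r ?l2norm_ge0 // P1_le.
- move=> x x0 n; rewrite -inner_ebasisr inner_conj -inner_adjoint conj_ge0.
  by apply: positive_inner => //; apply: P1_pos; exact: ebasis_pos.
Qed.

(** The adjoint as an element of [P1], so that everything proved for positive
    contractions applies to it. *)
Definition adj T : P1 R := locked (projT1 (cid (adjoint_exists T))).

Lemma adjE T x : adj T x = adjoint T x.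
Proof. by rewrite /adj -lock; case: cid. Qed.

Lemma inner_adj T x y : inner (T x) y = inner x (adj T y).
Proof. by rewrite adjE inner_adjoint. Qed.

Lemma inner_adjl T x y : inner (adj T x) y = inner x (T y).
Proof. by rewrite inner_conj -inner_adj -inner_conj. Qed.

Lemma adj_coord T x n : adj T x n = inner x (T (ebasis R n)).
Proof. by rewrite -inner_adjl inner_ebasisr. Qed.

End Adjoint.

(** * Norm-attaining operators: weak convergence forces norm convergence *)

Definition wot_cvg (R : realType) (F : set_system (P1 R)) (T : P1 R) :=
  forall x y (e : R), 0 < e ->
    \forall S \near F, normc (inner ((S : P1 R) x) y - inner (T x) y) <= e.

Section Rigidity.
Variable R : realType.
Implicit Types (x y z X Y : l2 R) (S T : P1 R).

Lemma wot_cvg_adj (F : set_system (P1 R)) T : Filter F -> wot_cvg F T ->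
  forall x y (e : R), 0 < e ->
  \forall S \near F, normc (inner (adj S x) y - inner (adj T x) y) <= e.
Proof.
move=> FF h x y e e0; apply: filterS (h y x e e0) => S.
by rewrite !inner_adjl (inner_conj (S y)) (inner_conj (T y)) -rmorphB /= normc_conj.
Qed.

Lemma l2norm_sub_sqr x y :
  (l2norm (x - y) ^+ 2 = l2norm x ^+ 2 + l2norm y ^+ 2 - 2 * complex.Re (inner x y)).
Proof.
have := inner_norm (x - y).
rewrite innerBl !innerBr !inner_norm (inner_conj x y).
by case: (inner x y) => a b [] /= <- _; ring.
Qed.

Lemma Re_le_normc (a : R[i]) : complex.Re a <= normc a.
Proof.
case: a => c d /=; apply: le_trans (ler_norm _) _.
by rewrite -sqrtr_sqr ler_wsqrtr // lerDl sqr_ge0.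
Qed.

(** Expand [||S X - Y||^2]: the norms of [S X] and [Y] are at most [||X||], and
    [<T X, Y> = ||Y||^2], so only the weak defect is left. *)
Lemma attained_norm_cvg S T X Y : T X = Y -> l2norm X = l2norm Y ->
  l2norm (S X - Y) ^+ 2 <= 2 * normc (inner (S X) Y - inner (T X) Y).
Proof.
move=> TX XY; rewrite l2norm_sub_sqr.
have h1 : l2norm (S X) ^+ 2 <= l2norm Y ^+ 2.
  by rewrite -XY ler_sqr ?nnegrE ?l2norm_ge0 // P1_le.
have h2 : complex.Re (inner (T X) Y) = l2norm Y ^+ 2 by rewrite TX inner_norm.
have := Re_le_normc (inner (T X) Y - inner (S X) Y).
rewrite raddfB /= h2 -normcN opprB; lra.
Qed.

Definition norm_attaining T := exists X Y : l2 R,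
  [/\ forall k, 0 < X k, forall k, 0 < Y k, T X = Y & adj T Y = X].

Lemma adj_attained_norm T X Y : T X = Y -> adj T Y = X -> l2norm X = l2norm Y.
Proof.
move=> TX TY; apply/eqP; rewrite eq_le; apply/andP; split.
  by rewrite -TY P1_le.
by rewrite -TX P1_le.
Qed.

Lemma ler_normc (a b : R[i]) : 0 <= a -> a <= b -> normc a <= normc b.
Proof.
move=> a0 ab; rewrite -lecR.
by change (`|a| <= `|b|); rewrite !ger0_norm // (le_trans a0 ab).
Qed.

(** Positivity enters here: [X_r e_r <= X] gives [X_r S e_r <= S X]
    coordinatewise, so one vector [S X] controls the tails of all columns. *)
Lemma tail_column S X r N : (forall n, 0 < X n) ->
  normc (X r) * l2norm (tail N (S (ebasis R r))) <= l2norm (tail N (S X)).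
Proof.
move=> X0; rewrite -l2normZ; apply: ler_l2norm => k.
rewrite l2_ZE !tailE; case: ltnP => _; first by rewrite mulr0.
apply: ler_normc.
  by apply: mulr_ge0; [exact: ltW|exact: P1_pos (@ebasis_pos R r) k].
rewrite -subr_ge0.
have -> : S X k - X r * S (ebasis R r) k = S (X - X r *: ebasis R r) k.
  have hZ : S (X r *: ebasis R r) = X r *: S (ebasis R r) by rewrite linearZ.
  rewrite linearB hZ.
  by rewrite [RHS]l2_DE [in RHS]l2_NE [in RHS]l2_ZE.
apply: P1_pos => n; rewrite l2_DE l2_NE l2_ZE ebasisE.
by case: eqVneq => [->|_]; rewrite ?mulr1 ?subrr // mulr0 subr0 ltW.
Qed.

(** Split at a coordinate [N] beyond which [Y] and [T e_r] are small.  The head of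
    [S e_r - T e_r] consists of finitely many matrix entries, which converge
    weakly; the tail of [S e_r] is dominated by that of [S X], which is close
    to [Y] in norm. *)
Lemma column_cvg (F : set_system (P1 R)) T X Y : Filter F ->
  (forall n, 0 < X n) -> T X = Y -> l2norm X = l2norm Y -> wot_cvg F T ->
  forall r (e : R), 0 < e ->
  \forall S \near F, l2norm ((S : P1 R) (ebasis R r) - T (ebasis R r)) <= e.
Proof.
move=> FF X0 TX XY FT r e e0.
have Xr0 : 0 < normc (X r).
  by rewrite -ltcR; change (0 < `|X r|); rewrite normr_gt0 gt_eqF.
have c0 : 0 < e / 4 by rewrite divr_gt0.
pose c := normc (X r) * (e / 4); have cp : 0 < c by rewrite mulr_gt0.
have [N [hN1 hN2]] : exists N, l2norm (tail N Y) <= c /\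
    l2norm (tail N (T (ebasis R r))) <= e / 4.
  suff : \forall N \near \oo, l2norm (tail N Y) <= c /\
    l2norm (tail N (T (ebasis R r))) <= e / 4 by move/filter_ex.
  have /cvgrPdist_le/(_ _ cp) h1 := tail_cvg Y.
  have /cvgrPdist_le/(_ _ c0) h2 := tail_cvg (T (ebasis R r)).
  apply: filterS2 h1 h2 => N; rewrite !sub0r !normrN => h1 h2.
  by split; [apply: le_trans h1|apply: le_trans h2]; exact: ler_norm.
have near1 : \forall S \near F, l2norm ((S : P1 R) X - Y) <= c.
  have d0 : 0 < c ^+ 2 / 2 by rewrite divr_gt0 ?exprn_gt0.
  apply: filterS (FT X Y _ d0) => S h.
  rewrite -ler_sqr ?nnegrE ?l2norm_ge0 ?(ltW cp) //.
  apply: le_trans (attained_norm_cvg S TX XY) _.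
  by rewrite mulrC -ler_pdivlMr.
have near2 : \forall S \near F,
    l2norm (head N ((S : P1 R) (ebasis R r) - T (ebasis R r))) <= e / 4.
  have d0 : 0 < e / 4 / N.+1%:R by rewrite divr_gt0.
  have hi : \forall S \near F, forall i : 'I_N,
     normc (((S : P1 R) (ebasis R r) - T (ebasis R r)) i) <= e / 4 / N.+1%:R.
    apply: filter_forall => i; apply: filterS (FT (ebasis R r) (ebasis R i) _ d0) => S.
    by rewrite -innerBl inner_ebasisr.
  apply: filterS hi => S h.
  apply: le_trans (l2norm_head_le _ _) _.
  apply: le_trans (ler_sum _ (fun i _ => h i)) _.
  rewrite sumr_const card_ord -[leLHS]mulr_natr -(mulrA (e / 4)) ler_piMr ?(ltW c0) //.
  by rewrite mulrC ltW // ltr_pdivrMr // mul1r ltr_nat.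
near=> S.
rewrite -(head_tail N (_ - _)).
have e4 : e = e / 4 + (e / 4 + e / 4 + e / 4) by field.
apply: le_trans (l2normD _ _) _; rewrite {1}e4 lerD //; first by near: S.
rewrite tailB; apply: le_trans (l2normD _ _) _; rewrite l2normN lerD //.
rewrite -(ler_pM2l Xr0); apply: le_trans (tail_column S r N X0) _.
rewrite mulrDr -/c -(subrK Y (S X)) addrC.
have -> : tail N (Y + (S X - Y)) = tail N (S X - Y) + tail N Y.
  by rewrite tailB subrK addrC subrK.
apply: le_trans (l2normD _ _) _; rewrite lerD //.
by apply: le_trans (l2norm_tail _ _) _; near: S.
Unshelve. all: by end_near. Qed.

End Rigidity.

(** * Schur's test for row-finite nonnegative matrices *)

Section Schur.
Variable R : realType.

(** A Cauchy-Schwarz inequality with weights [t c * X c] of total mass at most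
    [Y], obtained from [sum_c t_c (u_c - (S / Y) X_c)^2 / X_c >= 0] where [S]
    is the sum to be bounded. *)
Lemma schur_cauchy (n : nat) (t u X : nat -> R) (Y : R) :
  (forall c, 0 <= t c) -> (forall c, 0 < X c) -> 0 < Y ->
  \sum_(c < n) t c * X c <= Y ->
  (\sum_(c < n) t c * u c) ^+ 2 <= Y * \sum_(c < n) t c * (u c ^+ 2 / X c).
Proof.
move=> t0 X0 Y0 tXY.
set S := \sum_(c < n) t c * u c; set Q := \sum_(c < n) t c * (u c ^+ 2 / X c).
set P := \sum_(c < n) t c * X c in tXY.
have key : 0 <= Q - 2 * (S / Y) * S + (S / Y) ^+ 2 * P.
  have -> : Q - 2 * (S / Y) * S + (S / Y) ^+ 2 * P =
      \sum_(c < n) t c * ((u c - S / Y * X c) ^+ 2 / X c).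
    rewrite /Q /P {2}/S !mulr_sumr -sumrB -big_split /=; apply: eq_bigr => c _.
    by field; rewrite !gt_eqF.
  by apply: sumr_ge0 => c _; rewrite mulr_ge0 // divr_ge0 ?sqr_ge0 // ltW.
have : (S / Y) ^+ 2 * P <= (S / Y) ^+ 2 * Y by rewrite ler_wpM2l ?sqr_ge0.
have -> : (S / Y) ^+ 2 * Y = S ^+ 2 / Y by field; rewrite gt_eqF.
have e2 : 2 * (S / Y) * S = 2 * (S ^+ 2 / Y) by field; rewrite gt_eqF.
rewrite e2 in key.
move=> h; rewrite mulrC -ler_pdivrMr //; lra.
Qed.

Lemma normc_sum (n : nat) (g : nat -> R[i]) :
  normc (\sum_(c < n) g c) <= \sum_(c < n) normc (g c).
Proof.
elim: n => [|n IH]; first by rewrite !big_ord0 normc0.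
by rewrite !big_ord_recr /=; apply: le_trans (le_normcD _ _) _; rewrite lerD.
Qed.

Lemma normc_real (a : R) : 0 <= a -> normc a%:C = a.
Proof. by move=> a0; rewrite /= expr0n addr0 sqrtr_sqr ger0_norm. Qed.

Variables (t : nat -> nat -> R) (b : nat -> nat) (X Y : nat -> R).

(** Row [r] is meant to be supported below [b r], so that the matrix acts by
    finite sums on arbitrary sequences. *)
Definition row_op (f : nat -> R[i]) (r : nat) : R[i] :=
  \sum_(c < b r) (t r c)%:C * f c.

Hypothesis t0 : forall r c, 0 <= t r c.
Hypothesis X0 : forall c, 0 < X c.
Hypothesis Y0 : forall r, 0 < Y r.
Hypothesis rowP : forall r, \sum_(c < b r) t r c * X c <= Y r.
Hypothesis colP : forall L c, \sum_(r < L) t r c * Y r <= X c.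

Lemma row_op_sqsum (x : l2 R) L : sqsum (row_op x) L <= l2norm x ^+ 2.
Proof.
(* [schur_cauchy] bounds row [r] by [Y r * sum_c t r c * g c]; summing over [r]
   first, the column condition turns the weight of [g c] into [X c]. *)
pose g c := normc (x c) ^+ 2 / X c.
have g0 c : 0 <= g c by rewrite divr_ge0 ?sqr_ge0 // ltW.
pose B := (\sum_(r < L) b r)%N.
have hB (r : 'I_L) : (b r <= B)%N by rewrite /B (bigD1 r) //= leq_addr.
have row r : (r < L)%N -> normc (row_op x r) ^+ 2 <= Y r * \sum_(c < B) t r c * g c.
  move=> rL; have h1 : normc (row_op x r) <= \sum_(c < b r) t r c * normc (x c).
    apply: le_trans (@normc_sum _ (fun c => (t r c)%:C * x c)) _; apply: ler_sum => c _.
    by rewrite normcM normc_real.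
  have h2 : normc (row_op x r) ^+ 2 <= (\sum_(c < b r) t r c * normc (x c)) ^+ 2.
    by rewrite ler_sqr ?nnegrE ?normc_ge0 // (le_trans (normc_ge0 _) h1).
  apply: le_trans h2 _; 
  have := @schur_cauchy _ (t r) (fun c => normc (x c)) X _ (t0 r) X0 (Y0 r) (rowP r).
  move=> h3; apply: le_trans h3 _.
  rewrite ler_wpM2l ?(ltW (Y0 r)) //.
  rewrite (big_ord_widen B (fun c => t r c * g c) (hB (Ordinal rL))) /=.
  rewrite [leLHS]big_mkcond; apply: ler_sum => c _.
  by case: ifP => // _; rewrite mulr_ge0.
rewrite sqsumE; apply: le_trans (ler_sum _ (fun r _ => row _ (ltn_ord r))) _.
under eq_bigr do rewrite mulr_sumr.
rewrite exchange_big /=.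
apply: le_trans (sqsum_le_l2norm x B); rewrite sqsumE.
apply: ler_sum => c _.
have -> : \sum_(i < L) Y i * (t i c * g c) = g c * \sum_(i < L) t i c * Y i.
  by rewrite mulr_sumr; apply: eq_bigr => i _; ring.
apply: le_trans (ler_wpM2l (g0 c) (colP L c)) _.
by rewrite /g divfK // gt_eqF.
Qed.

Lemma schur_test : exists T : P1 R, forall x r, T x r = row_op x r.
Proof.
have H x := sqsum_bound (l2norm_ge0 x) (row_op_sqsum x).
pose f x : l2 R := L2 (H x).1.
suff [T TE] : exists T : P1 R, forall x, T x = f x by exists T => x r; rewrite TE.
apply: P1_exists.
- move=> a x y; apply: l2_ext => r; rewrite /= /row_op mulr_sumr -big_split /=.
  by apply: eq_bigr => c _; ring.
- by move=> x; exact: (H x).2.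
- move=> x x0 r; apply: sumr_ge0 => c _.
  by rewrite mulr_ge0 // ler0c.
Qed.

End Schur.

Section Transpose.
Variable R : realType.
Variables (t : nat -> nat -> R) (b b' : nat -> nat).

(** The column [T e_c] is finitely supported, so the coordinate [c] of the
    adjoint is a finite sum. *)
Lemma adj_row_op (T : P1 R) : (forall x r, T x r = row_op t b x r) ->
  (forall r c, (b r <= c)%N -> t r c = 0) ->
  (forall r c, (b' c <= r)%N -> t r c = 0) ->
  forall x c, adj T x c = row_op (fun r c => t c r) b' x c.
Proof.
move=> TE hb hb' x c.
have Tc : T (ebasis R c) = head (b' c) (fun r => (t r c)%:C).
  apply: l2_ext => r; rewrite TE /row_op headE.
  have -> : \sum_(k < b r) (t r k)%:C * ebasis R c k = (t r c)%:C.
    have [cb|cb] := ltnP c (b r); last first.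
      rewrite hb // big1 // => k _; rewrite ebasisE ltn_eqF ?mulr0 //.
      exact: leq_trans cb.
    rewrite (bigD1 (Ordinal cb)) //= ebasisE eqxx mulr1 big1 ?addr0 // => k.
    by rewrite -val_eqE /= ebasisE => /negbTE ->; rewrite mulr0.
  by case: ltnP => // /hb' ->.
rewrite adj_coord Tc inner_conj head_sum /row_op.
rewrite (_ : inner _ x = \sum_(k < b' c) (t k c)%:C * (x k)^*%C); last first.
  elim: (b' c) => [|n IH].
    by rewrite !big_ord0 -(scale0r 0) innerZ mul0r.
  by rewrite !big_ord_recr innerD IH innerZ inner_ebasisl.
rewrite rmorph_sum; apply: eq_bigr => k _.
by rewrite rmorphM /= conjcK oppr0.
Qed.

End Transpose.

(** * Approximate eigenvectors and shift chains *)

Section ApproximateEigenvectors.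
Variables (R : realType) (T : P1 R).
Implicit Types (p : l2 R * R[i]).

(** The error is relative to the norm, so that eigenvectors need no
    normalization; only finitely many coordinates are tested because a weak
    neighbourhood controls only finitely many columns. *)
Definition approx_eig (eta : R) (J : nat) : set (l2 R * R[i]) :=
  [set p : l2 R * R[i] | normc p.2 <= 1 /\ forall r, (r < J)%N ->
    normc (p.2 * p.1 r - T p.1 r) <= eta * l2norm p.1].

(** A filter, so that statements about all sufficiently good approximate
    eigenvectors combine over finitely many coordinates. *)
Definition approx_eig_filter : set_system (l2 R * R[i]) :=
  filter_from [set q : R * nat | 0 < q.1] (fun q => approx_eig q.1 q.2).

Lemma approx_eigS eta eta' J J' : eta <= eta' -> (J' <= J)%N ->
  approx_eig eta J `<=` approx_eig eta' J'.
Proof.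
move=> le1 le2 p [p1 h]; split => // r rJ; apply: le_trans (h r (leq_trans rJ le2)) _.
by rewrite ler_wpM2r ?l2norm_ge0.
Qed.

#[global] Instance approx_eig_filterP : Filter approx_eig_filter.
Proof.
apply: filter_from_filter; first by exists (1, 0%N) => /=.
move=> [e1 J1] [e2 J2] /= h1 h2; exists (Num.min e1 e2, maxn J1 J2) => /=.
  by rewrite lt_min h1.
move=> p hp; split; apply: approx_eigS hp;
  by rewrite ?ge_min ?lexx ?orbT ?leq_maxl ?leq_maxr.
Qed.

Lemma near_approx_eig (eta : R) J : 0 < eta ->
  \forall p \near approx_eig_filter, approx_eig eta J p.
Proof. by move=> e0; exists (eta, J). Qed.

(** A robust form of: the coordinate [n] of every eigenvector for an eigenvalue
    in the closed unit disc is zero. *)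
Definition negligible_coord n := forall d : R, 0 < d ->
  \forall p \near approx_eig_filter, normc ((p.1 : l2 R) n) <= d * l2norm p.1.

Lemma sum_injective_le (x : l2 R) (s : nat -> nat) K : injective s ->
  \sum_(k < K) normc (x (s k)) ^+ 2 <= l2norm x ^+ 2.
Proof.
move=> sI; pose B := (\sum_(k < K) (s k).+1)%N.
have sB (k : 'I_K) : (s k < B)%N by rewrite /B (bigD1 k) //= leq_addr.
apply: le_trans (sqsum_le_l2norm x B); rewrite sqsumE.
pose g i := normc (x i) ^+ 2.
have -> : \sum_(k < K) normc (x (s k)) ^+ 2 =
    \sum_(i < B) \sum_(k < K) (i == s k :> nat)%:R * g i.
  rewrite exchange_big; apply: eq_bigr => k _ /=.
  rewrite (bigD1 (Ordinal (sB k))) //= eqxx mul1r big1 ?addr0 // => i.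
  by rewrite -val_eqE /= => /negbTE ->; rewrite mul0r.
apply: ler_sum => i _; rewrite -mulr_suml ler_piMl ?sqr_ge0 //.
have [[k /eqP ik]|no] := pselect (exists k : 'I_K, i == s k :> nat).
  rewrite (bigD1 k) //= ik eqxx big1 ?addr0 // => k' kk'.
  case: eqP => // /sI /ord_inj h; by rewrite h eqxx in kk'.
rewrite big1 // => k _; case: eqP => // ik; case: no; exists k; exact/eqP.
Qed.

(** From [l x_(s (k+1)) = x_(s k)] and [|l| <= 1] the moduli [|x_(s k)|] do not
    decrease with [k], so [K] of them that exceed [c ||x||] contradict
    square-summability as soon as [K c^2 > 1].  An error [c / K] at each step is
    affordable. *)
Lemma negligible_chain (s : nat -> nat) (v : R) : injective s -> 0 < v ->
  (forall x, T x (s 1%N) = v%:C * x (s 0%N)) ->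
  (forall x k, T x (s k.+2) = x (s k.+1)) ->
  negligible_coord (s 0%N).
Proof.
move=> sI v0 hT0 hT d d0.
pose c := v * d / 2; have c0 : 0 < c by rewrite divr_gt0 ?mulr_gt0.
pose K := (Num.truncn (c ^- 2)).+1.
have Kc : 1 < K%:R * c ^+ 2.
  rewrite -ltr_pdivrMr ?exprn_gt0 // mul1r.
  by have /truncn_itv/andP[] : 0 <= c ^- 2 by rewrite invr_ge0 sqr_ge0.
have K0 : 0 < K%:R :> R by rewrite ltr0n.
pose eta := c / K%:R.
have eta0 : 0 < eta by rewrite divr_gt0.
pose J := (\sum_(k < K.+1) (s k).+1)%N.
have sJ k : (k <= K)%N -> (s k < J)%N.
  by move=> kK; rewrite /J (bigD1 (Ordinal (kK : (k < K.+1)%N))) //= leq_addr.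
apply: filterS (near_approx_eig J eta0) => -[x l] [/= l1 h].
set N := l2norm x in h *.
have N0 : 0 <= N by exact: l2norm_ge0.
have step r y : (r < J)%N -> T x r = y -> normc y <= normc (x r) + eta * N.
  move=> rJ Tx.
  have -> : y = l * x r + - (l * x r - T x r) by rewrite Tx opprB addrC subrK.
  apply: le_trans (le_normcD _ _) _; rewrite normcN lerD ?h //.
  by rewrite normcM ler_piMl ?normc_ge0.
have chain k : (k < K)%N ->
    v * normc (x (s 0%N)) <= normc (x (s k.+1)) + k.+1%:R * (eta * N).
  elim: k => [|k IH] kK.
    rewrite mul1r -(normc_real (ltW v0)) -normcM; apply: step; [exact: sJ|exact: hT0].
  apply: le_trans (IH (ltnW kK)) _.
  rewrite -[k.+2]add1n natrD mulrDl mul1r addrA lerD2r.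
  by apply: step; [exact: sJ|exact: hT].
have [N00|N1] := eqVneq N 0.
  by rewrite N00 mulr0 -N00 normc_le_l2norm.
have {}N1 : 0 < N by rewrite lt_neqAle eq_sym N1.
rewrite leNgt; apply/negP => hlt.
have big k : (k < K)%N -> c * N <= normc (x (s k.+1)).
  move=> kK; have := chain k kK.
  have : k.+1%:R * (eta * N) <= c * N.
    rewrite mulrA ler_wpM2r // /eta mulrCA ler_piMr ?(ltW c0) //.
    by rewrite ler_pdivrMr // mul1r ler_nat.
  have : v * (d * N) < v * normc (x (s 0%N)) by rewrite ltr_pM2l.
  rewrite /c; lra.
have := sum_injective_le x K (s := fun k => s k.+1) (fun i j h => succn_inj (sI _ _ h)).
apply/negP; rewrite -ltNge.
have : \sum_(k < K) (c * N) ^+ 2 <= \sum_(k < K) normc (x (s k.+1)) ^+ 2.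
  apply: ler_sum => k _; rewrite ler_sqr ?nnegrE ?normc_ge0 ?(mulr_ge0 (ltW c0) N0) //.
  exact: big.
move=> hs; apply: lt_le_trans hs.
rewrite sumr_const card_ord -[ltRHS]mulr_natl exprMn mulrA ltr_pMl ?exprn_gt0 //.
Qed.

(** Solve the equation at the coordinate [r] for its last term: the others are
    already negligible. *)
Lemma negligible_backward (m : nat) (a : nat -> R[i]) (v : R) r n :
  (forall c, (c < m)%N -> negligible_coord c) -> negligible_coord r -> 0 < v ->
  (forall x, T x r = \sum_(c < m) a c * x c + v%:C * x n) ->
  negligible_coord n.
Proof.
move=> hm hr v0 hT d d0.
pose M := \sum_(c < m) normc (a c) + 2.
have M0 : 0 < M by rewrite ltr_wpDl // sumr_ge0 // => c _; exact: normc_ge0.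
pose e := v * d / M; have e0 : 0 < e by rewrite divr_gt0 ?mulr_gt0.
have hm' : \forall p \near approx_eig_filter, forall c : 'I_m,
    normc ((p.1 : l2 R) c) <= e * l2norm p.1.
  by apply: filter_forall => c; apply: hm.
apply: filterS3 (near_approx_eig r.+1 e0) hm' (hr e e0) => -[x l] /= [/= l1 h] hc hxr.
have {}h := h r (ltnSn r).
rewrite -(ler_pM2l v0) -{1}(normc_real (ltW v0)) -normcM.
have -> : v%:C * x n = - (l * x r - T x r) + l * x r + - \sum_(c < m) a c * x c.
  by rewrite hT; ring.
have -> : v * (d * l2norm x) = e * l2norm x + e * l2norm x +
    \sum_(c < m) normc (a c) * (e * l2norm x).
  rewrite -mulr_suml.
  have -> : \sum_(c < m) normc (a c) = M - 2 by rewrite /M addrK.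
  by rewrite /e; field; rewrite gt_eqF.
apply: le_trans (le_normcD _ _) _; rewrite lerD //.
  apply: le_trans (le_normcD _ _) _; rewrite normcN lerD // normcM.
  by apply: le_trans hxr; rewrite ler_piMl ?normc_ge0.
rewrite normcN; apply: le_trans (@normc_sum _ _ (fun c => a c * x c)) _.
by apply: ler_sum => c _; rewrite normcM ler_wpM2l ?normc_ge0.
Qed.

End ApproximateEigenvectors.

Section CoreFlow.
Variable R : realType.

(** A permutation [sigma] of the coordinates, with inverse [tau], all of whose
    orbits are infinite and pass exactly once through the core [0, ..., m-1].
    The definition is symmetric under exchanging [sigma] and [tau], which
    corresponds to transposing the operators below. *)
Record core_flow (m : nat) (sigma tau : nat -> nat) : Prop := CoreFlow {
  flowK : cancel sigma tau ;
  flowVK : cancel tau sigma ;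
  flow_out : forall j k, (j < m)%N -> (m <= iter k.+1 sigma j)%N ;
  flow_in : forall j k, (j < m)%N -> (m <= iter k.+1 tau j)%N ;
  flow_cover : forall n, exists j k, (j < m)%N /\
    (n = iter k sigma j \/ n = iter k tau j) }.

Lemma core_flowC m sigma tau : core_flow m sigma tau -> core_flow m tau sigma.
Proof.
case=> h1 h2 h3 h4 h5; split => // n.
by have [j [k [jm [h|h]]]] := h5 n; exists j, k; split => //; [right|left].
Qed.

Lemma flow_orbit_inj m sigma tau j : core_flow m sigma tau -> (j < m)%N ->
  injective (fun k => iter k sigma j).
Proof.
case=> h1 _ h3 _ _ jm.
have sI : injective sigma by exact: can_inj h1.
have main k i : iter k sigma j = iter (k + i) sigma j -> i = 0%N.
  elim: k => [|k IH] /=; last by move/sI.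
  case: i => // i /esym /= e; exfalso; have := h3 j i jm; by rewrite /= e leqNgt jm.
move=> k i /= e; have [ki|ik] := leqP k i.
  have := main k (i - k)%N; rewrite subnKC // => /(_ e)/eqP; rewrite subn_eq0 => ik.
  by apply/eqP; rewrite eqn_leq ki.
have := main i (k - i)%N; rewrite subnKC ?(ltnW ik) // => /(_ (esym e))/eqP.
by rewrite subn_eq0 leqNgt ik.
Qed.

(** The core matrix [B] plus weighted edges [tau r -> r] along the chains. *)
Definition flow_op m (B : nat -> nat -> R) (w : nat -> R) (tau : nat -> nat)
    (T : P1 R) :=
  forall x r, T x r = (if (r < m)%N then \sum_(c < m) (B r c)%:C * x c else 0)
                      + (w r)%:C * x (tau r).

(** Forward orbits of core coordinates are chains for [negligible_chain]; the
    backward orbits are then reached one step at a time.  The first edge of a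
    chain may have any positive weight, so the weights of the edges at the core
    are free. *)
Lemma flow_negligible m B w sigma tau (T : P1 R) : core_flow m sigma tau ->
  flow_op m B w tau T -> (forall r, 0 < w r) ->
  (forall r, (m <= r)%N -> (m <= tau r)%N -> w r = 1) ->
  forall n, negligible_coord T n.
Proof.
move=> fl TE w0 w1.
have fwd j k : (j < m)%N -> negligible_coord T (iter k sigma j).
  move=> jm; have sK i : tau (iter i.+1 sigma j) = iter i sigma j.
    by rewrite /= (flowK fl).
  have out i : (m <= iter i.+1 sigma j)%N by exact: flow_out fl _ _ jm.
  apply: (@negligible_chain _ T (fun i => iter (i + k) sigma j)
    (w (iter k.+1 sigma j))).
  - by move=> a b /= /(flow_orbit_inj fl jm) /addIn.
  - exact: w0.
  - by move=> x; rewrite TE add1n ltnNge out add0r sK.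
  - move=> x i; rewrite TE !addSn ltnNge out add0r sK w1 ?mul1r //.
    by rewrite sK.
have core c : (c < m)%N -> negligible_coord T c by exact: (fwd c 0%N).
move=> n; have [j [k [jm [->|->]]]] := flow_cover fl n; first exact: fwd.
elim: k => [|k IH]; first exact: core.
pose r := iter k tau j.
pose a c := if (r < m)%N then (B r c)%:C else 0.
apply: (@negligible_backward _ T m a (w r) r) => //.
move=> x; rewrite TE /a; congr (_ + _); case: ifP => // _.
by rewrite big1 // => c _; rewrite mul0r.
Qed.

End CoreFlow.

(** * Strict Schur vectors of a strictly contractive nonnegative matrix *)

Section StrictSchurVectors.
Variables (R : realType) (M : nat).
Implicit Types (v : 'cV[R]_M).

Definition sqn v : R := \sum_i v i 0 ^+ 2.

Lemma sqnE v : sqn v = (v^T *m v) 0 0.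
Proof. by rewrite mxE; apply: eq_bigr => i _; rewrite mxE expr2. Qed.

Lemma sqn_ge0 v : 0 <= sqn v.
Proof. by apply: sumr_ge0 => i _; exact: sqr_ge0. Qed.

Lemma sqn_eq0 v : sqn v <= 0 -> v = 0.
Proof.
move=> h; have /eqP : sqn v == 0 by rewrite eq_le h sqn_ge0.
move/psumr_eq0P => H; apply/matrixP => i j; rewrite ord1 mxE; apply/eqP.
by rewrite -sqrf_eq0; apply/eqP/H => // k _; exact: sqr_ge0.
Qed.

Variables (A : 'M[R]_M) (rho : R).
Hypothesis A0 : forall i j, 0 <= A i j.
Hypothesis rho1 : rho < 1.
Hypothesis Arho : forall v, sqn (A *m v) <= rho * sqn v.

Lemma contraction_eq0 v : sqn v <= sqn (A *m v) -> v = 0.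
Proof.
move=> h; apply: sqn_eq0; have := le_trans h (Arho v); have := sqn_ge0 v.
have := rho1; nra.
Qed.

Lemma resolvent_unit : (1%:M - A^T *m A) \in unitmx.
Proof.
rewrite -row_free_unit; apply: inj_row_free => v.
rewrite mulmxBr mulmx1 => /eqP; rewrite subr_eq0 => /eqP hv.
apply: (can_inj (@trmxK _ _ _)); rewrite trmx0; apply: contraction_eq0.
rewrite !sqnE trmxK {1}hv le_eqVlt; apply/orP; left; apply/eqP.
by rewrite trmx_mul trmxK !mulmxA.
Qed.

Lemma mulmx_ge0 (B : 'M[R]_M) v : (forall i j, 0 <= B i j) ->
  (forall i, 0 <= v i 0) -> forall i, 0 <= (B *m v) i 0.
Proof. by move=> B0 v0 i; rewrite mxE sumr_ge0 // => j _; rewrite mulr_ge0. Qed.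

(** Let [p] be the negative part of [v] and [q = v + p] its positive part.
    Testing the equation against [p] gives
    [- |p|^2 = <p, 1> + <A p, A q> - |A p|^2 >= - |A p|^2], so [A] does not
    contract [p], whence [p = 0]. *)
Lemma resolvent_pos v : v = const_mx 1 + A^T *m (A *m v) -> forall i, 1 <= v i 0.
Proof.
move=> hv.
pose p : 'cV[R]_M := \col_i Num.max (- v i 0) 0.
pose q := v + p.
have p0 i : 0 <= p i 0 by rewrite mxE le_max lexx orbT.
have q0 i : 0 <= q i 0.
  by rewrite !mxE; case: (leP (- v i 0) 0) => ?; lra.
have pv : (p^T *m v) 0 0 = - sqn p.
  rewrite mxE /sqn -sumrN; apply: eq_bigr => i _; rewrite !mxE.
  by case: (leP (- v i 0) 0) => ?; ring.
have p_eq0 : p = 0.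
  apply: contraction_eq0; rewrite -lerN2 -pv {1}hv mulmxDr mxE.
  have -> : (p^T *m (A^T *m (A *m v))) 0 0 =
      ((A *m p)^T *m (A *m q)) 0 0 - sqn (A *m p).
    rewrite sqnE /q !mulmxDr [X in _ = X - _]mxE addrK.
    by rewrite trmx_mul !mulmxA.
  rewrite addrA lerDr addr_ge0 //.
    rewrite mxE sumr_ge0 // => i _; rewrite mxE mulr_ge0 //.
    by rewrite [const_mx 1 _ _]mxE.
  rewrite mxE sumr_ge0 // => i _; rewrite mxE mulr_ge0 //; exact: mulmx_ge0.
have v0 i : 0 <= v i 0 by have := q0 i; rewrite /q p_eq0 addr0.
move=> i; rewrite hv [X in _ <= X]mxE [const_mx 1 _ _]mxE lerDl.
apply: mulmx_ge0; first by move=> k l; rewrite mxE.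
exact: mulmx_ge0.
Qed.

(** Take [x] solving [x = 1 + A^T A x], with [1] the all-ones vector, so that
    [A^T (A x) = x - 1] leaves room for adding a small constant to [y = A x]. *)
Lemma strict_schur_vectors : exists x y : 'cV[R]_M,
  [/\ forall i, 0 < x i 0, forall i, 0 < y i 0,
      forall i, (A *m x) i 0 < y i 0 & forall i, (A^T *m y) i 0 < x i 0].
Proof.
pose x := invmx (1%:M - A^T *m A) *m (const_mx 1 : 'cV[R]_M).
have hx : x = const_mx 1 + A^T *m (A *m x).
  apply/eqP; rewrite -subr_eq; apply/eqP.
  by rewrite mulmxA -{1}(mul1mx x) -mulmxBl /x mulKVmx ?resolvent_unit.
have x1 := resolvent_pos hx.
have x0 i : 0 < x i 0 by apply: lt_le_trans (x1 i).
have Ax0 : forall i, 0 <= (A *m x) i 0 by apply: mulmx_ge0 => // i; exact: ltW.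
pose s := \sum_i \sum_j A i j.
have s0 : 0 <= s by apply: sumr_ge0 => i _; apply: sumr_ge0 => j _.
pose e := (1 + s)^-1.
have e0 : 0 < e by rewrite invr_gt0 ltr_wpDr.
exists x, (A *m x + const_mx e); split => //.
- by move=> i; rewrite mxE [const_mx e _ _]mxE ltr_wpDl.
- by move=> i; rewrite [ltRHS]mxE [const_mx e _ _]mxE ltrDl.
move=> i; rewrite mulmxDr [ltLHS]mxE [in ltRHS]hx [ltRHS]mxE addrC ltrD2r.
rewrite [const_mx 1 _ _]mxE mxE.
have -> : \sum_j A^T i j * (const_mx e : 'cV[R]_M) j 0 = e * \sum_j A j i.
  by rewrite mulr_sumr; apply: eq_bigr => j _; rewrite !mxE mulrC.
rewrite /e mulrC ltr_pdivrMr ?mul1r; last by rewrite ltr_wpDr.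
apply: le_lt_trans (_ : s < _); last by rewrite ltrDr.
apply: ler_sum => j _; rewrite (bigD1 i) //= lerDl sumr_ge0 //.
Qed.

End StrictSchurVectors.

(** * Threading chains through a finite core *)

Section ZigzagFlow.
Implicit Types (k b m : nat).

(** The successor in the ordering [..., 5, 3, 1, 0, 2, 4, ...] of the naturals: a
    single two-sided infinite orbit through [0], with inverse [zag]. *)
Definition zig b := if odd b then (if b == 1%N then 0%N else (b - 2)%N) else b.+2.
Definition zag b := if odd b then b.+2 else (if b == 0%N then 1%N else (b - 2)%N).

Lemma zigK : cancel zig zag.
Proof.
case=> [|[|b]] //; rewrite /zig /zag /= !subSS !subn0.
by case: (boolP (odd b)) => /= [|/negbTE] h; rewrite ?h /= ?subn2.
Qed.

Lemma zagK : cancel zag zig.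
Proof.
case=> [|[|b]] //; rewrite /zig /zag /= !subSS !subn0.
by case: (boolP (odd b)) => /= [|/negbTE] h; rewrite ?h /= ?subn2.
Qed.

Lemma iter_zig k : iter k zig 0%N = k.*2.
Proof. by elim: k => // k /= ->; rewrite /zig odd_double. Qed.

Lemma iter_zag k : iter k.+1 zag 0%N = k.*2.+1.
Proof. by elim: k => // k IH; rewrite iterS IH /zag /= odd_double. Qed.

(** Copies of one permutation acting on block numbers, one for each residue
    modulo [m]; the core is the block [0]. *)
Definition blockwise m (f : nat -> nat) k := (f (k %/ m) * m + k %% m)%N.

Lemma blockwiseK m f g : (0 < m)%N -> cancel f g ->
  cancel (blockwise m f) (blockwise m g).
Proof.
move=> m0 fK k; rewrite /blockwise.
by rewrite divnMDl // (divn_small (ltn_pmod k m0)) addn0 modnMDl modn_mod fK -divn_eq.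
Qed.

Lemma iter_blockwise m f k j : (j < m)%N ->
  iter k (blockwise m f) j = (iter k f 0 * m + j)%N.
Proof.
move=> jm; elim: k => [|k IH] /=; first by rewrite mul0n.
rewrite IH /blockwise divnMDl ?(leq_ltn_trans _ jm) // (divn_small jm) addn0.
by rewrite modnMDl modn_small.
Qed.

Lemma zigzag_core_flow m : (0 < m)%N -> core_flow m (blockwise m zig) (blockwise m zag).
Proof.
move=> m0; split.
- exact: blockwiseK zigK.
- exact: blockwiseK zagK.
- move=> j k jm; rewrite iter_blockwise // iter_zig.
  by rewrite doubleS mulSn -addnA leq_addr.
- by move=> j k jm; rewrite iter_blockwise // iter_zag mulSn -addnA leq_addr.
move=> n; exists (n %% m)%N; case: (boolP (odd (n %/ m))) => h.
  exists (n %/ m)./2.+1; split; first by rewrite ltn_pmod.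
  right; rewrite iter_blockwise ?ltn_pmod // iter_zag {1}(divn_eq n m).
  congr (_ * _ + _)%N.
  by rewrite -[LHS]odd_double_half h.
exists (n %/ m)./2; split; first by rewrite ltn_pmod.
left; rewrite iter_blockwise ?ltn_pmod // iter_zig {1}(divn_eq n m).
congr (_ * _ + _)%N.
by rewrite -[LHS]odd_double_half (negbTE h).
Qed.

End ZigzagFlow.

Section FlowConstruction.
Variable R : realType.

(** Its entries serve as values of the test vectors far out on the chains. *)
Lemma geometric_l2 : exists G : l2 R, forall k, 0 < G k.
Proof.
pose u k : R[i] := (2^-1 ^+ k : R)%:C.
have u0 k : 0 < (2^-1 ^+ k : R) by rewrite exprn_gt0 // invr_gt0.
have H n : sqsum u n <= 2 - 2 * 2^-1 ^+ n.
  elim: n => [|n IH]; first by rewrite sqsumE big_ord0 expr0 mulr1 subrr.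
  rewrite sqsumS normc_real ?(ltW (u0 n)) // [in leRHS]exprS.
  have : (2^-1 ^+ n : R) <= 1 by rewrite exprn_ile1 // ?invr_ge0 // invf_le1 // ler1n.
  have := u0 n; move: IH; set v := 2^-1 ^+ n => IH v0 v1.
  have e : 2 * (2^-1 * v) = v by field.
  by rewrite e; nra.
have H2 n : sqsum u n <= 2 ^+ 2.
  by apply: le_trans (H n) _; have := u0 n; lra.
have [us _] := sqsum_bound (ler0n R 2) H2.
by exists (L2 us) => k; rewrite ltcR.
Qed.

Definition flow_entry (m : nat) (B : nat -> nat -> R) (w : nat -> R)
    (tau : nat -> nat) r c : R :=
  (if (c < m)%N then (if (r < m)%N then B r c else 0) else 0) + w r * (c == tau r)%:R.

Lemma flow_entryC m B w sigma tau r c : cancel sigma tau -> cancel tau sigma ->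
  flow_entry m B w tau r c = flow_entry m (fun r c => B c r) (w \o sigma) sigma c r.
Proof.
move=> sK tK; rewrite /flow_entry; congr (_ + _).
  by case: ltnP; case: ltnP.
have -> : (c == tau r) = (r == sigma c) by rewrite eq_sym (can2_eq tK sK).
by case: eqP => [->|_] /=; rewrite ?mulr0.
Qed.

Lemma flow_sum (K : pzRingType) (a f : nat -> K) (v : K) m k n :
  (m <= n)%N -> (k < n)%N ->
  \sum_(c < n) ((if (c < m)%N then a c else 0) + v * (c == k :> nat)%:R) * f c =
  \sum_(c < m) a c * f c + v * f k.
Proof.
move=> mn kn; under eq_bigr do rewrite mulrDl.
rewrite big_split /=; congr (_ + _).
  rewrite (big_ord_widen n (fun c => a c * f c) mn) [RHS]big_mkcond.
  by apply: eq_bigr => c _; case: ifP => // _; rewrite mul0r.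
rewrite (bigD1 (Ordinal kn)) //= eqxx mulr1 big1 ?addr0 // => c.
by rewrite -val_eqE /= => /negbTE ->; rewrite mulr0 mul0r.
Qed.

Lemma flow_row_op m B w tau (f : nat -> R[i]) r :
  row_op (flow_entry m B w tau) (fun r => maxn m (tau r).+1) f r =
  (if (r < m)%N then \sum_(c < m) (B r c)%:C * f c else 0) + (w r)%:C * f (tau r).
Proof.
pose a c : R[i] := (if (r < m)%N then B r c else 0)%:C.
have -> : (if (r < m)%N then \sum_(c < m) (B r c)%:C * f c else 0) =
    \sum_(c < m) a c * f c.
  by rewrite /a; case: ifP => // _; rewrite big1 // => c _; rewrite mul0r.
rewrite -(flow_sum a f _ (leq_maxl m (tau r).+1) (leq_maxr m (tau r).+1)).
rewrite /row_op; apply: eq_bigr => c _; congr (_ * _).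
rewrite /flow_entry rmorphD rmorphM /= rmorph_nat; congr (_ + _).
by case: ifP.
Qed.

Variables (m : nat) (sigma tau : nat -> nat) (B : nat -> nat -> R) (x y : nat -> R).
Hypothesis fl : core_flow m sigma tau.
Hypothesis B0 : forall r c, 0 <= B r c.
Hypothesis x0 : forall c, 0 < x c.
Hypothesis y0 : forall c, 0 < y c.
Hypothesis Bx : forall r, (r < m)%N -> \sum_(c < m) B r c * x c < y r.
Hypothesis By : forall c, (c < m)%N -> \sum_(r < m) B r c * y r < x c.

(** An edge of this weight is crossed once by the operator and once by its
    transpose, so its square makes up for the missing proportion [1 - u / v]. *)
Definition deficit (u v : R) : R := Num.sqrt (1 - u / v).

Lemma deficit_gt0 u v : 0 < v -> u < v -> 0 < deficit u v.
Proof. by move=> v0 uv; rewrite sqrtr_gt0 subr_gt0 ltr_pdivrMr // mul1r. Qed.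

Lemma deficitE u v : 0 < v -> u < v -> u + deficit u v ^+ 2 * v = v.
Proof.
move=> v0 uv; rewrite sqr_sqrtr; first by field; rewrite gt_eqF.
by rewrite subr_ge0 ler_pdivrMr // mul1r ltW.
Qed.

Let alpha r := deficit (\sum_(c < m) B r c * x c) (y r).
Let beta c := deficit (\sum_(r < m) B r c * y r) (x c).

Let w r := if (r < m)%N then alpha r
           else if (tau r < m)%N then beta (tau r) else 1.

Let w0 r : 0 < w r.
Proof.
rewrite /w; case: ltnP => [/Bx|_]; first exact: deficit_gt0.
by case: ltnP => // /By; exact: deficit_gt0.
Qed.

Let tau_out r : (r < m)%N -> (m <= tau r)%N.
Proof. exact: (flow_in fl 0). Qed.

Let sigma_out r : (r < m)%N -> (m <= sigma r)%N.
Proof. exact: (flow_out fl 0). Qed.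

(* The value of [X] just before the core is dictated by the row equation at the
   core; farther out [X] is the free parameter [G], and [Y] repeats it. *)
Let X (G : nat -> R) k := if (k < m)%N then x k
  else if (sigma k < m)%N then alpha (sigma k) * y (sigma k) else G k.

Let Y G r := if (r < m)%N then y r else w r * X G (tau r).

Let X0 G : (forall k, 0 < G k) -> forall k, 0 < X G k.
Proof.
move=> G0 k; rewrite /X; case: ltnP => // _; case: ltnP => // h.
by rewrite mulr_gt0 //; apply: deficit_gt0 => //; exact: Bx.
Qed.

Let Y0 G : (forall k, 0 < G k) -> forall k, 0 < Y G k.
Proof. by move=> G0 k; rewrite /Y; case: ltnP => // _; rewrite mulr_gt0 // X0. Qed.

Let rowE G r :
  (if (r < m)%N then \sum_(c < m) B r c * X G c else 0) + w r * X G (tau r) = Y G r.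
Proof.
rewrite /Y; case: ltnP => rm; last by rewrite add0r.
rewrite /w rm {2}/X ltnNge tau_out //= (flowVK fl) rm.
have -> : \sum_(c < m) B r c * X G c = \sum_(c < m) B r c * x c.
  by apply: eq_bigr => c _; rewrite /X ltn_ord.
by rewrite mulrA -expr2; apply: deficitE => //; exact: Bx.
Qed.

Let colE G c : (if (c < m)%N then \sum_(r < m) B r c * Y G r else 0) +
  w (sigma c) * Y G (sigma c) = X G c.
Proof.
rewrite {2}/Y /w (flowK fl); case: (ltnP c m) => cm.
  rewrite ltnNge sigma_out //= /X cm.
  have -> : \sum_(r < m) B r c * Y G r = \sum_(r < m) B r c * y r.
    by apply: eq_bigr => r _; rewrite /Y ltn_ord.
  by rewrite mulrA -expr2; apply: deficitE => //; exact: By.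
rewrite add0r; case: (ltnP (sigma c) m) => h; last by rewrite !mul1r.
by rewrite /X (ltnNge c m) cm h.
Qed.

(** Only finitely many entries of [X] differ from those of [G]. *)
Lemma X_summable (G : l2 R) : (forall k, 0 < G k) ->
  square_summable (fun k => (X (fun k => complex.Re (G k)) k)%:C).
Proof.
move=> G0; pose u k : R[i] := (X (fun k => complex.Re (G k)) k)%:C.
pose K := maxn m (\sum_(j < m) (tau j).+1)%N.
suff uE : u = head K u + tail K G by rewrite -/u uE; exact: l2P.
apply/funext => k; rewrite l2_DE headE tailE.
case: ltnP => [_|]; first by rewrite addr0.
rewrite geq_max add0r => /andP[mk tk]; rewrite /u /X ltnNge mk /=.
case: ltnP => h; last first.
  by have := G0 k; rewrite ltcE; case: (G k) => a b /= /andP[/eqP -> _].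
move: tk; rewrite (bigD1 (Ordinal h)) //= (flowK fl) => /(leq_trans (leq_addr _ _)).
by rewrite ltnn.
Qed.

(** The test vectors [X, Y] satisfy the row and column conditions of Schur's test
    with equality, so the same computation bounds the operator and shows that it
    attains its norm. *)
Lemma flow_construction : exists (w' : nat -> R) (T : P1 R),
  [/\ forall r, 0 < w' r,
      forall r, (m <= r)%N -> (m <= tau r)%N -> w' r = 1,
      forall r, (r < m)%N -> w' r = alpha r /\ w' (sigma r) = beta r,
      flow_op m B w' tau T /\ flow_op m (fun r c => B c r) (w' \o sigma) sigma (adj T) &
      norm_attaining T].
Proof.
have [Gv Gv0] := geometric_l2.
pose G k := complex.Re (Gv k).
have G0 k : 0 < G k by have := Gv0 k; rewrite ltcE => /andP[].
pose t := flow_entry m B w tau.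
pose b r := maxn m (tau r).+1; pose b' c := maxn m (sigma c).+1.
have t0 r c : 0 <= t r c.
  by rewrite /t /flow_entry addr_ge0 ?mulr_ge0 ?(ltW (w0 r)) //; do 2 case: ifP => // _.
have rowP r : \sum_(c < b r) t r c * X G c <= Y G r.
  rewrite (flow_sum (fun c => if (r < m)%N then B r c else 0) _ _
    (leq_maxl _ _) (leq_maxr _ _)).
  rewrite -(rowE G r) lerD2r; case: ifP => // _.
  by rewrite big1 // => c _; rewrite mul0r.
have colP L c : \sum_(r < L) t r c * Y G r <= X G c.
  pose n := maxn L (b' c).
  apply: (@le_trans _ _ (\sum_(r < n) t r c * Y G r)).
    rewrite (big_ord_widen n (fun r => t r c * Y G r) (leq_maxl _ _)) big_mkcond.
    by apply: ler_sum => r _; case: ifP => // _; rewrite mulr_ge0 // ltW // Y0.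
  under eq_bigr do rewrite /t (flow_entryC _ _ _ _ _ (flowK fl) (flowVK fl)).
  rewrite (flow_sum (fun r => if (c < m)%N then B r c else 0)); last 2 first.
  - by rewrite (leq_trans (leq_maxl m (sigma c).+1)) // leq_maxr.
  - by rewrite (leq_trans (leq_maxr m (sigma c).+1)) // leq_maxr.
  rewrite -(colE G c) lerD2r; case: ifP => // _.
  by rewrite big1 // => r _; rewrite mul0r.
have [T TE] := schur_test t0 (X0 G0) (Y0 G0) rowP colP.
have adjTE := adj_row_op TE (b' := b').
have TE2 : flow_op m B w tau T by move=> f r; rewrite TE flow_row_op.
have adjE2 : flow_op m (fun r c => B c r) (w \o sigma) sigma (adj T).
  move=> f c; rewrite adjTE.
  - rewrite (_ : row_op _ _ _ _ =
      row_op (flow_entry m (fun r c => B c r) (w \o sigma) sigma) b' f c).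
      by rewrite flow_row_op.
    apply: eq_bigr => r _; congr (_%:C * _).
    exact: flow_entryC (flowK fl) (flowVK fl).
  - move=> r d; rewrite geq_max => /andP[md td]; rewrite /t /flow_entry ltnNge md /=.
    by rewrite gtn_eqF // mulr0 addr0.
  - move=> r d; rewrite geq_max => /andP[md td].
    rewrite /t (flow_entryC _ _ _ _ _ (flowK fl) (flowVK fl)) /flow_entry ltnNge md /=.
    by rewrite gtn_eqF // mulr0 addr0.
pose Xv : l2 R := L2 (X_summable Gv0).
have TX r : T Xv r = (Y G r)%:C.
  rewrite TE2 -(rowE G r) rmorphD rmorphM /=; congr (_ + _).
  by case: ifP => // _; rewrite rmorph_sum; apply: eq_bigr => c _; rewrite rmorphM.
exists w, T; split => //.
- by move=> r mr mt; rewrite /w !ltnNge mr mt.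
- move=> r rm; rewrite /w rm (flowK fl) rm.
  by rewrite ltnNge sigma_out.
exists Xv, (T Xv); split => //.
- by move=> k; rewrite ltcR; exact: X0.
- by move=> k; rewrite TX ltcR; exact: Y0.
apply: l2_ext => c; rewrite adjE2 /Xv /= -(colE G c) rmorphD rmorphM /= TX.
congr (_ + _).
case: ifP => // _; rewrite rmorph_sum; apply: eq_bigr => r _.
by rewrite rmorphM /= TX.
Qed.

End FlowConstruction.

(** * Approximation of a positive contraction *)

Section Density.
Variable R : realType.
Implicit Types (S T : P1 R).

Lemma strict_schur_seq (M : nat) (a : nat -> nat -> R) (rho : R) :
  (forall i j, 0 <= a i j) -> rho < 1 ->
  (forall u : nat -> R, \sum_(i < M) (\sum_(j < M) a i j * u j) ^+ 2 <=
     rho * \sum_(j < M) u j ^+ 2) ->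
  exists x y : nat -> R, [/\ forall i, 0 < x i, forall i, 0 < y i,
    forall i, (i < M)%N -> \sum_(j < M) a i j * x j < y i &
    forall j, (j < M)%N -> \sum_(i < M) a i j * y i < x j].
Proof.
move=> a0 rho1 ha.
pose ext (v : 'cV[R]_M) i := if insub i is Some k then v k 0 else 1.
have extE v (k : 'I_M) : ext v k = v k 0 by rewrite /ext valK.
have ext0 (v : 'cV[R]_M) : (forall k, 0 < v k 0) -> forall i, 0 < ext v i.
  by move=> v0 i; rewrite /ext; case: insubP.
have [||x [y [x0 y0 hx hy]]] :=
  @strict_schur_vectors R M (\matrix_(i, j) a i j) rho _ rho1.
- by move=> i j; rewrite mxE.
- move=> v; rewrite /sqn.
  have := ha (ext v); under [in leRHS]eq_bigr do rewrite extE.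
  apply: le_trans; rewrite le_eqVlt; apply/orP; left; apply/eqP.
  apply: eq_bigr => i _; rewrite mxE; congr (_ ^+ 2); apply: eq_bigr => j _.
  by rewrite mxE extE.
exists (ext x), (ext y); split; try exact: ext0.
- move=> i iM; have := hx (Ordinal iM); rewrite -(extE y) /= mxE.
  by rewrite (eq_bigr (fun j : 'I_M => a i j * ext x j)) // => j _; rewrite mxE extE.
- move=> i iM; have := hy (Ordinal iM); rewrite -(extE x) /= mxE.
  by rewrite (eq_bigr (fun j : 'I_M => a j i * ext y j)) // => j _; rewrite !mxE extE.
Qed.

Definition entry T i j : R := complex.Re (T (ebasis R j) i).

Lemma entryE T i j : T (ebasis R j) i = (entry T i j)%:C.
Proof.
have := P1_pos T (@ebasis_pos R j) i; rewrite /entry lecE.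
by case: (T _ i) => a b /= /andP[/eqP -> _].
Qed.

Lemma entry_ge0 T i j : 0 <= entry T i j.
Proof. by rewrite -ler0c -entryE; exact: P1_pos (@ebasis_pos R j) i. Qed.

Lemma entry_adj T i j : entry (adj T) i j = entry T j i.
Proof.
by apply: complexI; rewrite -!entryE adj_coord inner_ebasisl entryE conjc_real.
Qed.

(** The corner is a compression of a contraction. *)
Lemma corner_contraction T M (u : nat -> R) :
  \sum_(i < M) (\sum_(j < M) entry T i j * u j) ^+ 2 <= \sum_(j < M) u j ^+ 2.
Proof.
pose v := head M (fun j => (u j)%:C).
have nE (z : R) : normc z%:C ^+ 2 = z ^+ 2.
  by rewrite /= expr0n addr0 sqr_sqrtr ?sqr_ge0.
have Tv i : T v i = (\sum_(j < M) entry T i j * u j)%:C.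
  rewrite /v head_sum linear_sum rmorph_sum /=.
  elim: M {v} => [|M IH]; first by rewrite !big_ord0.
  rewrite !big_ord_recr l2_DE IH /=; congr (_ + _).
  by rewrite linearZ l2_ZE entryE rmorphM mulrC.
have hv : l2norm v ^+ 2 <= \sum_(j < M) u j ^+ 2.
  have s0 : 0 <= \sum_(j < M) u j ^+ 2 by apply: sumr_ge0 => j _; exact: sqr_ge0.
  rewrite -[leRHS]sqr_sqrtr // ler_sqr ?nnegrE ?l2norm_ge0 ?sqrtr_ge0 //.
  apply: l2norm_sqsum_bound; first exact: sqrtr_ge0.
  move=> n; rewrite sqr_sqrtr //; apply: le_trans (sqsum_head _ _ _) _.
  by rewrite sqsumE; under eq_bigr do rewrite nE.
apply: le_trans hv.
have h : l2norm (T v) ^+ 2 <= l2norm v ^+ 2.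
  by rewrite ler_sqr ?nnegrE ?l2norm_ge0 // P1_le.
apply: le_trans h; apply: le_trans (sqsum_le_l2norm _ M); rewrite sqsumE.
by under [leRHS]eq_bigr do rewrite Tv nE.
Qed.

Lemma flow_column m B w sigma tau T j : core_flow m sigma tau -> flow_op m B w tau T ->
  (j < m)%N -> T (ebasis R j) =
  head m (fun r => (B r j)%:C) + (w (sigma j))%:C *: ebasis R (sigma j).
Proof.
move=> fl TE jm; apply: l2_ext => r; rewrite TE l2_DE l2_ZE headE !ebasisE.
congr (_ + _).
  case: ifP => // _; rewrite (bigD1 (Ordinal jm)) //= ebasisE eqxx mulr1.
  rewrite big1 ?addr0 // => c.
  by rewrite -val_eqE /= ebasisE => /negbTE ->; rewrite mulr0.
rewrite (can2_eq (flowVK fl) (flowK fl)).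
by case: eqP => [->|_] //; rewrite !mulr0.
Qed.

(** The four contributions to the error: the corner is shrunk by [1 - g], the
    entry at the extra coordinate [M] and the edge leaving [j] are at most [g],
    and the part of [S e_j] beyond [M] is cut off. *)
Lemma column_approx M B w sigma tau T S j (g : R) : core_flow M.+1 sigma tau ->
  flow_op M.+1 B w tau T -> (j < M)%N -> 0 <= g ->
  (forall r, (r < M)%N -> B r j = (1 - g) * entry S r j) ->
  0 <= B M j <= g -> w (sigma j) = g ->
  l2norm (T (ebasis R j) - S (ebasis R j)) <= 3 * g + l2norm (tail M (S (ebasis R j))).
Proof.
move=> fl TE jM g0 hB /andP[BM0 BMg] wg.
rewrite (flow_column fl TE (leqW jM)) wg headS.
have -> : head M (fun r => (B r j)%:C) = (1 - g)%:C *: head M (S (ebasis R j)).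
  apply: l2_ext => r; rewrite l2_ZE !headE; case: ltnP => [rM|_]; last by rewrite mulr0.
  by rewrite hB // entryE rmorphM.
set Se := S _.
have -> : (1 - g)%:C *: head M Se + (B M j)%:C *: ebasis R M
      + g%:C *: ebasis R (sigma j) - Se
    = (- g)%:C *: head M Se + (B M j)%:C *: ebasis R M + g%:C *: ebasis R (sigma j)
      - tail M Se.
  rewrite -{2}(head_tail M Se); apply: l2_ext => k.
  do 8 rewrite ?l2_DE ?l2_NE ?l2_ZE.
  by rewrite rmorphB rmorphN /=; ring.
have small (z : R) k : 0 <= z <= g -> l2norm (z%:C *: ebasis R k) <= g.
  move=> /andP[z0 zg]; rewrite l2normZ normc_real //; apply: le_trans zg.
  by rewrite ler_piMr // l2norm_ebasis.
apply: le_trans (l2normD _ _) _; rewrite l2normN lerD2r.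
have e3 : 3 * g = g + g + g by ring.
rewrite e3; apply: le_trans (l2normD _ _) _; rewrite lerD //; last first.
  by apply: small; rewrite g0 lexx.
apply: le_trans (l2normD _ _) _; rewrite lerD //; last by apply: small; rewrite BM0.
have -> : l2norm ((- g)%:C *: head M Se) = g * l2norm (head M Se).
  by rewrite l2normZ /= expr0n addr0 sqrtr_sqr normrN ger0_norm.
rewrite ler_piMr //.
apply: le_trans (l2norm_head _ _) _; apply: le_trans (P1_le _ _) _.
exact: l2norm_ebasis.
Qed.

(** Strict Schur vectors of the corner divided by [1 + g] show that
    [A = (1 - g) * corner] satisfies [A x < (1 - g^2) y] and
    [A^T y < (1 - g^2) x]; the entries at the extra coordinate are chosen so that
    the total deficit of each of the first [M] rows and columns is exactly
    [g^2], that is, so that [deficit] returns [g]. *)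
Lemma flow_approx T1 M (g := (M.+2%:R)^-1 : R) : exists T,
  [/\ norm_attaining T,
      forall n, negligible_coord T n, forall n, negligible_coord (adj T) n &
      forall j, (j < M)%N ->
        l2norm (T (ebasis R j) - T1 (ebasis R j)) <=
           3 * g + l2norm (tail M (T1 (ebasis R j)))
        /\ l2norm (adj T (ebasis R j) - adj T1 (ebasis R j)) <=
           3 * g + l2norm (tail M (adj T1 (ebasis R j)))].
Proof.
have g0 : 0 < g by rewrite invr_gt0 ltr0n.
have g1 : g < 1 by rewrite invf_lt1 ?ltr0n // ltr1n.
pose a := entry T1.
have a0 i j : 0 <= a i j by exact: entry_ge0.
have [||| x [y [x0 y0 hx hy]]] :=
  @strict_schur_seq M (fun i j => a i j / (1 + g)) ((1 + g) ^- 2).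
- by move=> i j; rewrite divr_ge0 // addr_ge0 // ltW.
- by rewrite invf_lt1 ?exprn_gt0 ?exprn_egt1 ?addr_gt0 // ltrDl.
- move=> u.
  have -> : \sum_(i < M) (\sum_(j < M) a i j / (1 + g) * u j) ^+ 2 =
     (1 + g) ^- 2 * \sum_(i < M) (\sum_(j < M) a i j * u j) ^+ 2.
    rewrite mulr_sumr; apply: eq_bigr => i _; rewrite -exprVn -exprMn mulr_sumr.
    by congr (_ ^+ 2); apply: eq_bigr => j _; ring.
  by rewrite ler_wpM2l ?invr_ge0 ?sqr_ge0 // corner_contraction.
pose d i := (1 - g ^+ 2) * y i - (1 - g) * \sum_(j < M) a i j * x j.
pose e j := (1 - g ^+ 2) * x j - (1 - g) * \sum_(i < M) a i j * y i.
have g10 : 0 < 1 + g by rewrite addr_gt0.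
have d0 i : (i < M)%N -> 0 < d i.
  move=> iM; have := hx i iM.
  have -> : \sum_(j < M) a i j / (1 + g) * x j = (\sum_(j < M) a i j * x j) / (1 + g).
    by rewrite mulr_suml; apply: eq_bigr => j _; ring.
  rewrite ltr_pdivrMr // => h; rewrite subr_gt0.
  have -> : (1 - g ^+ 2) * y i = (1 - g) * (y i * (1 + g)) by ring.
  by rewrite ltr_pM2l // subr_gt0.
have e0 i : (i < M)%N -> 0 < e i.
  move=> iM; have := hy i iM.
  have -> : \sum_(j < M) a j i / (1 + g) * y j = (\sum_(j < M) a j i * y j) / (1 + g).
    by rewrite mulr_suml; apply: eq_bigr => j _; ring.
  rewrite ltr_pdivrMr // => h; rewrite subr_gt0.
  have -> : (1 - g ^+ 2) * x i = (1 - g) * (x i * (1 + g)) by ring.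
  by rewrite ltr_pM2l // subr_gt0.
pose sd := \sum_(i < M) d i; pose se := \sum_(i < M) e i.
pose sey := \sum_(i < M) e i * x i; pose sdx := \sum_(i < M) d i * y i.
have sd0 : 0 <= sd by apply: sumr_ge0 => i _; rewrite ltW // d0.
have se0 : 0 <= se by apply: sumr_ge0 => i _; rewrite ltW // e0.
have sey0 : 0 <= sey by apply: sumr_ge0 => i _; rewrite ltW // mulr_gt0 // e0.
have sdx0 : 0 <= sdx by apply: sumr_ge0 => i _; rewrite ltW // mulr_gt0 // d0.
(* The value of both test vectors at the extra coordinate [M]: large enough for
   the entries [d r / h], [e c / h] to be at most [g] and for row and column [M]
   to keep a positive deficit. *)
pose h := 1 + (sd + se) / g + sey + sdx.
have q0 : 0 <= (sd + se) / g by rewrite divr_ge0 ?addr_ge0 // ltW.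
have h1 : 1 <= h by rewrite /h; lra.
have h0 : 0 < h by rewrite (lt_le_trans ltr01).
have hg : sd + se <= h * g.
  rewrite -ler_pdivrMr // /h; lra.
pose B r c := if (r < M)%N then (if (c < M)%N then (1 - g) * a r c else d r / h)
              else (if (c < M)%N then e c / h else 0).
pose x' c := if (c < M)%N then x c else h.
pose y' c := if (c < M)%N then y c else h.
have B0 r c : 0 <= B r c.
  rewrite /B; case: ltnP => rM; case: ltnP => cM //.
  - by rewrite mulr_ge0 // subr_ge0 ltW.
  - by rewrite divr_ge0 ?ltW // d0.
  - by rewrite divr_ge0 ?ltW // e0.
have BxE r : (r < M)%N -> \sum_(c < M.+1) B r c * x' c = (1 - g ^+ 2) * y r.
  move=> rM; rewrite big_ord_recr /= {2}/B {2}/x' rM ltnn divfK ?gt_eqF //.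
  have -> : \sum_(i < M) B r i * x' i = (1 - g) * \sum_(j < M) a r j * x j.
    by rewrite mulr_sumr; apply: eq_bigr => c _; rewrite /B /x' rM ltn_ord mulrA.
  by rewrite /d addrC subrK.
have ByE c : (c < M)%N -> \sum_(r < M.+1) B r c * y' r = (1 - g ^+ 2) * x c.
  move=> cM; rewrite big_ord_recr /= {2}/B {2}/y' cM ltnn divfK ?gt_eqF //.
  have -> : \sum_(i < M) B i c * y' i = (1 - g) * \sum_(j < M) a j c * y j.
    by rewrite mulr_sumr; apply: eq_bigr => r _; rewrite /B /y' cM ltn_ord mulrA.
  by rewrite /e addrC subrK.
have hh : sey < h * h /\ sdx < h * h.
  have hh : h <= h * h by rewrite ler_pMl.
  by split; apply: lt_le_trans hh; rewrite /h; lra.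
have Bx r : (r < M.+1)%N -> \sum_(c < M.+1) B r c * x' c < y' r.
  rewrite ltnS leq_eqVlt => /orP[/eqP ->|rM].
    rewrite /y' ltnn big_ord_recr /= {2}/B ltnn mul0r addr0.
    have -> : \sum_(i < M) B M i * x' i = sey / h.
      rewrite /sey mulr_suml; apply: eq_bigr => c _.
      by rewrite /B /x' ltnn ltn_ord; ring.
    by rewrite ltr_pdivrMr //; case: hh.
  rewrite BxE // /y' rM gtr_pMl // ltrBlDr ltrDl exprn_gt0 //.
have By c : (c < M.+1)%N -> \sum_(r < M.+1) B r c * y' r < x' c.
  rewrite ltnS leq_eqVlt => /orP[/eqP ->|cM].
    rewrite /x' ltnn big_ord_recr /= {2}/B ltnn mul0r addr0.
    have -> : \sum_(i < M) B i M * y' i = sdx / h.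
      rewrite /sdx mulr_suml; apply: eq_bigr => r _.
      by rewrite /B /y' ltnn ltn_ord; ring.
    by rewrite ltr_pdivrMr //; case: hh.
  rewrite ByE // /x' cM gtr_pMl // ltrBlDr ltrDl exprn_gt0 //.
have x'0 c : 0 < x' c by rewrite /x'; case: ifP.
have y'0 c : 0 < y' c by rewrite /y'; case: ifP.
have fl := zigzag_core_flow (ltn0Sn M).
have [w [T [w0 w1 wE [TE TE'] hXY]]] := flow_construction fl B0 x'0 y'0 Bx By.
have def (z : R) : 0 < z -> deficit ((1 - g ^+ 2) * z) z = g.
  move=> z0; rewrite /deficit mulfK ?gt_eqF // opprB addrC subrK.
  by rewrite sqrtr_sqr ger0_norm // ltW.
exists T; split => //.
- exact: flow_negligible fl TE w0 w1.
- apply: flow_negligible (core_flowC fl) TE' _ _ => [r|r rm sm] /=; first exact: w0.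
  by apply: w1 => //; rewrite (flowK fl).
move=> j jM; have [wj wsj] := wE j (leqW jM).
have le_sum (f : nat -> R) i : (forall k, (k < M)%N -> 0 < f k) -> (i < M)%N ->
    f i <= \sum_(k < M) f k.
  move=> f0 iM; rewrite (bigD1 (Ordinal iM)) //= lerDl sumr_ge0 // => k _.
  by rewrite ltW // f0.
split.
  apply: (column_approx fl TE) => //; first exact: ltW.
  - by move=> r rM; rewrite /B rM jM.
  - rewrite B0 /B ltnn jM ler_pdivrMr // mulrC; apply: le_trans hg.
    by apply: le_trans (le_sum e j e0 jM) _; rewrite lerDr.
  - by rewrite wsj ByE // /x' jM def.
apply: (column_approx (core_flowC fl) TE') => //; first exact: ltW.
- by move=> r rM; rewrite /B rM jM entry_adj.
- rewrite B0 /B ltnn jM ler_pdivrMr // mulrC; apply: le_trans hg.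
  by apply: le_trans (le_sum d j d0 jM) _; rewrite lerDl.
- by rewrite /= (flowVK fl) wj BxE // /y' jM def.
Qed.

End Density.

(** * From flat eigenvectors to typical operators *)

Section Typical.
Variable R : realType.
Implicit Types (S T : P1 R).

Lemma eigenvalue_le1 T (l : R[i]) (x : l2 R) : x != 0 -> T x = l *: x -> normc l <= 1.
Proof.
move=> x0 Tx; have := P1_le T x.
by rewrite Tx l2normZ ger_pMl // l2norm_gt0.
Qed.

(** The same [k] bounds the coordinates and the size, so that a single sequence
    of conditions excludes all eigenvectors. *)
Definition flat_eigenvectors (k : nat) T := forall l (x : l2 R), T x = l *: x ->
  forall n, (n < k)%N -> k%:R * normc (x n) <= l2norm x.

Lemma flat_no_eigenvalue T : (forall k, flat_eigenvectors k T) -> no_eigenvalue T.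
Proof.
move=> h l [x x0 Tx]; move/eqP: x0; apply; apply: l2_ext => n.
apply: eq0_normc; apply/eqP; apply: contraT => xn0.
have {}xn0 : 0 < normc (x n) by rewrite lt_neqAle eq_sym xn0 normc_ge0.
pose k := maxn n.+1 (Num.truncn (l2norm x / normc (x n))).+1.
have := h k l x Tx n (leq_maxl _ _); rewrite leNgt => /negP []; rewrite -ltr_pdivrMr //.
have /truncn_itv/andP[_ hk] : 0 <= l2norm x / normc (x n).
  by rewrite divr_ge0 ?l2norm_ge0 ?ltW.
by apply: lt_le_trans hk _; rewrite ler_nat leq_maxr.
Qed.

Definition adjoint_pair S S' := forall x y, inner (S x) y = inner x (S' y).

(** If [S x = l x], then [l x_r - (T x)_r = <x, (S' - T') e_r>], so an eigenvector
    of [S] is an approximate eigenvector of [T].  Stating this for adjoint pairs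
    allows both [(S, adj S)] and [(adj S, S)]. *)
Lemma flat_of_close T T' k : adjoint_pair T T' ->
  (forall n, negligible_coord T n) ->
  exists (eta : R) (J : nat), 0 < eta /\ forall S S', adjoint_pair S S' ->
    (forall r, (r < J)%N ->
       l2norm (S' (ebasis R r) - T' (ebasis R r)) <= eta) ->
    flat_eigenvectors k S.
Proof.
move=> TT' hT.
have : \forall p \near approx_eig_filter T, forall n : 'I_k,
    normc ((p.1 : l2 R) n) <= k.+1%:R^-1 * l2norm p.1.
  by apply: filter_forall => n; apply: hT; rewrite invr_gt0.
case=> -[eta J] /= eta0 hJ; exists eta, J; split => // S S' SS' hS l x Sx n nk.
have [->|x0] := eqVneq x 0; first by rewrite l2_0E normc0 mulr0 l2norm_ge0.
have {hJ} : normc (x n) <= k.+1%:R^-1 * l2norm x.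
  apply: (hJ (x, l) _ (Ordinal nk)); split; first exact: eigenvalue_le1 Sx.
  move=> r rJ /=; have -> : l * x r = S x r by rewrite Sx.
  rewrite -(inner_ebasisr (S x)) -(inner_ebasisr (T x)) SS' TT' -innerBr.
  apply: le_trans (inner_le _ _) _.
  by rewrite mulrC ler_wpM2r ?l2norm_ge0 // hS.
rewrite mulrC ler_pdivlMr // mulrC; apply: le_trans.
by rewrite ler_wpM2r ?normc_ge0 // ler_nat.
Qed.

(** Such a [T] is interior, for the weak topology, to the set of operators that
    are k-flat together with their adjoint. *)
Lemma near_flat_wot (F : set_system (P1 R)) T k : Filter F -> norm_attaining T ->
  (forall n, negligible_coord T n) -> (forall n, negligible_coord (adj T) n) ->
  wot_cvg F T ->
  \forall S \near F, flat_eigenvectors k S /\ flat_eigenvectors k (adj S).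
Proof.
move=> FF [X [Y [X0 Y0 TX TY]]] hT hT' FT.
have XY := adj_attained_norm TX TY.
have c1 := column_cvg FF X0 TX XY FT.
have c2 r (e : R) : 0 < e ->
    \forall S \near F, l2norm (adj S (ebasis R r) - adj T (ebasis R r)) <= e.
  move=> e0; have FF' : Filter (@adj R @ F) by exact: fmap_filter.
  have FT' : wot_cvg (@adj R @ F) (adj T).
    by move=> x y e' e'0; exact: wot_cvg_adj FT x y e' e'0.
  exact: (@column_cvg R (@adj R @ F) (adj T) Y X FF' Y0 TY (esym XY) FT' r e e0).
have [e1 [J1 [e1p h1]]] := flat_of_close k (@inner_adj R T) hT.
have [e2 [J2 [e2p h2]]] := flat_of_close k (@inner_adjl R T) hT'.
have c1' : \forall S \near F, forall r : 'I_J2,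
    l2norm ((S : P1 R) (ebasis R r) - T (ebasis R r)) <= e2.
  by apply: filter_forall => r; exact: c1.
have c2' : \forall S \near F, forall r : 'I_J1,
    l2norm (adj S (ebasis R r) - adj T (ebasis R r)) <= e1.
  by apply: filter_forall => r; exact: c2.
apply: filterS2 c1' c2' => S hS hS'; split.
  by apply: (h1 S (adj S) (@inner_adj R S)) => r rJ; exact: (hS' (Ordinal rJ)).
by apply: (h2 (adj S) S (@inner_adjl R S)) => r rJ; exact: (hS (Ordinal rJ)).
Qed.

(** Contractions are equicontinuous and the basis vectors span a dense subspace. *)
Lemma strong_cvg_columns (Tn : nat -> P1 R) T :
  (forall j,
     (fun M => l2norm (Tn M (ebasis R j) - T (ebasis R j))) @ \oo --> (0 : R)) ->
  forall x, (fun M => Tn M x) @ \oo --> T x.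
Proof.
move=> h x; apply/cvgrPdist_le => e; rewrite ltcE => /andP[/eqP eI e0].
have e3 : 0 < complex.Re e / 3 by rewrite divr_gt0.
have [N hN] : exists N, l2norm (tail N x) <= complex.Re e / 3.
  have /cvgrPdist_le/(_ _ e3)/filter_ex[N] := tail_cvg x.
  by rewrite sub0r normrN => hN; exists N; apply: le_trans hN; exact: ler_norm.
have : \forall M \near \oo, l2norm (Tn M (head N x) - T (head N x)) <= complex.Re e / 3.
  pose g M := \sum_(j < N) normc (x j) * l2norm (Tn M (ebasis R j) - T (ebasis R j)).
  have gE : g @ \oo --> (0 : R).
    rewrite /g; elim: (N) => [|K IH].
      by under eq_fun do rewrite big_ord0; exact: cvg_cst.
    have := cvgD IH (cvgM (cvg_cst (normc (x K))) (h K)); rewrite mulr0 addr0.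
    move=> H; apply: cvg_trans (H _ _ _).
    by apply: near_eq_cvg; apply: nearW => M; rewrite big_ord_recr.
  have /cvgrPdist_le/(_ _ e3) := gE; apply: filterS => M.
  rewrite sub0r normrN => hM; apply: le_trans hM; apply: le_trans (ler_norm _).
  have lin (S : P1 R) : S (head N x) = \sum_(j < N) x j *: S (ebasis R j).
    by rewrite head_sum linear_sum; apply: eq_bigr => j _; rewrite linearZ.
  rewrite !lin -sumrB /g; elim: N {hN g gE lin} => [|N IH].
    by rewrite !big_ord0 l2norm0.
  rewrite !big_ord_recr /=; apply: le_trans (l2normD _ _) _.
  by rewrite lerD // -scalerBr l2normZ.
apply: filterS => M hM; rewrite l2normE lecE /= eI eqxx /= l2norm_distC.
have -> : Tn M x - T x =
    (Tn M (head N x) - T (head N x)) + (Tn M (tail N x) - T (tail N x)).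
  have split_at (S : P1 R) : S x = S (head N x) + S (tail N x).
    by rewrite -linearD head_tail.
  by rewrite (split_at (Tn M)) (split_at T) opprD addrACA.
have ee : complex.Re e = complex.Re e / 3 + (complex.Re e / 3 + complex.Re e / 3).
  by field.
rewrite ee; apply: le_trans (l2normD _ _) _; rewrite lerD //.
apply: le_trans (l2normD _ _) _; rewrite l2normN.
by rewrite lerD // (le_trans (P1_le _ _)).
Qed.

Lemma column_bound_cvg (f : nat -> R) (j : nat) (x : l2 R) :
  (forall M, (j < M)%N -> 0 <= f M <= 3 * M.+2%:R^-1 + l2norm (tail M x)) ->
  f @ \oo --> (0 : R).
Proof.
move=> h.
apply: (@squeeze_cvgr _ _ _ _ (fun=> 0) (fun M => 3 * M.+2%:R^-1 + l2norm (tail M x))).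
- by near=> M; apply: h; near: M; exact: nbhs_infty_gt.
- exact: cvg_cst.
- rewrite -[X in _ --> X](addr0 0); apply: cvgD; last exact: tail_cvg.
  rewrite -[X in _ --> X](mulr0 3); apply: cvgM; first exact: cvg_cst.
  have := @cvg_harmonic R; rewrite -(cvg_shiftS (@harmonic R : nat -> R^o)).
  exact.
Unshelve. all: by end_near. Qed.

Lemma nbhs_coarser (X : Type) (tau1 tau2 : Topological X) (p : X) (A : set X) :
  coarser tau1 tau2 -> @nbhs X (Topological.Pack tau1) p A ->
  @nbhs X (Topological.Pack tau2) p A.
Proof.
move=> h; rewrite (@nbhsE (Topological.Pack tau1)) => -[B [oB Bp] BA].
rewrite (@nbhsE (Topological.Pack tau2)); exists B => //; split => //; exact: h.
Qed.

End Typical.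

Theorem theorem1p6 (R : realType) (tau : Topological (P1 R))
  (tau_polish : polish R (Topological.Pack tau))
  (WOT_tau : coarser (WOT R) tau) (tau_SOTs : coarser tau (SOTs R)) :
  typical tau (fun T : P1 R => no_eigenvalue T /\ no_eigenvalue (adjoint T)).
Proof.
pose E k : set (Topological.Pack tau) :=
  [set T : P1 R | flat_eigenvectors k T /\ flat_eigenvectors k (adj T)].
exists (\bigcap_k (E k)°); split.
- by exists (fun k => (E k)°) => // k; exact: open_interior.
- move=> O [T1 OT1] oO.
  have /choice[Tn hTn] := flow_approx T1.
  have nearO : (Tn @ \oo) O.
    have cvgT : (Tn @ \oo) --> (T1 : Topological.Pack (SOTs R)).
      apply/SOTs_cvgP => x; split.
        apply: (strong_cvg_columns (Tn := Tn)) => j.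
        apply: (@column_bound_cvg _ _ j (T1 (ebasis R j))) => M jM.
        by rewrite l2norm_ge0; have [_ _ _ /(_ j jM)[]] := hTn M.
      rewrite -adjE; suff c : (fun M => adj (Tn M) x) @ \oo --> adj T1 x.
        have adjTn : (fun M => adj (Tn M) x) = (fun M => adjoint (Tn M) x).
          by apply/funext => M; rewrite adjE.
        by rewrite adjTn in c; exact: c.
      apply: (strong_cvg_columns (Tn := fun M => adj (Tn M))) => j.
      apply: (@column_bound_cvg _ _ j (adj T1 (ebasis R j))) => M jM.
      by rewrite l2norm_ge0; have [_ _ _ /(_ j jM)[]] := hTn M.
    apply: cvgT; apply: (@open_nbhs_nbhs (Topological.Pack (SOTs R))); split => //.
    exact: tau_SOTs.
  have [M OM] := filter_ex (nearO : \forall M \near \oo, O (Tn M)).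
  exists (Tn M); split => // k _.
  have [att n1 n2 _] := hTn M.
  pose F : set_system (P1 R) := @nbhs _ (Topological.Pack tau) (Tn M).
  have FF : Filter F by exact: (@nbhs_filter (Topological.Pack tau) (Tn M)).
  have cvgF : F --> (Tn M : Topological.Pack (WOT R)).
    by move=> A; exact: nbhs_coarser.
  apply: (@near_flat_wot R F (Tn M) k FF att n1 n2) => x y e e0.
  have /WOT_cvgP/(_ y x)/cvgrPdist_le/(_ e%:C) := cvgF.
  rewrite ltcR => /(_ e0) near_e.
  have {near_e} : \forall S \near F,
      `|inner y (Tn M x) - inner y ((S : P1 R) x)| <= e%:C.
    exact: near_e.
  apply: filterS => S.
  rewrite (inner_conj y (S x)) (inner_conj y (Tn M x)).
  by rewrite -rmorphB /= -lecR normc_conj -normcN opprB.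
move=> T hT; have h k : E k T by apply: interior_subset; exact: hT.
split; first by apply: flat_no_eigenvalue => k; have [] := h k.
have : no_eigenvalue (adj T) by apply: flat_no_eigenvalue => k; have [] := h k.
by move=> h' l [x x0 Tx]; apply: (h' l); exists x => //; rewrite adjE.
Qed.
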